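(* Let $P\subset\mathbb{E}^n$ be a convex polyhedral set and $\mathbf{p}_0\in\mathbb{E}^n$. Then the function $V_{P,\mathbf{p}_0,n}$ can be extended to a meromorphic function on some punctured neighborhood of $r=\infty$ in the Riemann sphere, with at most a pole at $r=\infty$, of order not greater than $n$. That is, there exist $R>0$ and a function $F$ holomorphic on $\{r\in\mathbb{C}: |r|>R\}$ such that $r^{-n}F(r)$ is bounded as $|r|\to\infty$ and $F(r)=V_{P,\mathbf{p}_0,n}(r)$ for all real $r>R$.
   Context: A (convex) polyhedral set is a nonempty subset of $\mathbb{E}^n$ that is the intersection of finitely many (possibly zero) closed halfspaces. For such $P$ and a point $\mathbf{p}_0$, define $V_{P,\mathbf{p}_0,n}(r)=0$ for $r<0$ and $V_{P,\mathbf{p}_0,n}(r)=\mathrm{Vol}_n[P\cap B_n(\mathbf{p}_0,r)]$ for $r\ge0$, where $B_n(\mathbf{p}_0,r)$ is the closed ball of radius $r$ centered at $\mathbf{p}_0$. *)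

(* Defs.v *)
From Stdlib Require Import Reals.
From HB Require Import structures.
From mathcomp Require Import all_boot all_order all_algebra.
From mathcomp Require Import all_classical all_reals all_analysis.
From mathcomp Require Import Rstruct Rstruct_topology.

Set Implicit Arguments.
Unset Strict Implicit.
Unset Printing Implicit Defensive.
Import Order.TTheory GRing.Theory Num.Theory.
Import numFieldNormedType.Exports.
Local Open Scope classical_set_scope.
Local Open Scope ring_scope.

Definition dotv (n : nat) (a x : 'rV[R]_n) : R :=
  \sum_(i < n) a ord0 i * x ord0 i.

Definition eucl_norm (n : nat) (x : 'rV[R]_n) : R :=
  Num.sqrt (\sum_(i < n) x ord0 i ^+ 2).

Definition cball (n : nat) (p : 'rV[R]_n) (r : R) : set 'rV[R]_n :=
  [set x | eucl_norm (x - p) <= r].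

Definition halfspace (n : nat) (a : 'rV[R]_n) (b : R) : set 'rV[R]_n :=
  [set x | dotv a x <= b].

Definition polyhedral_set (n : nat) (P : set 'rV[R]_n) : Prop :=
  P !=set0 /\
  exists (m : nat) (a : 'I_m -> 'rV[R]_n) (b : 'I_m -> R),
    (forall i, a i != 0) /\
    P = \bigcap_(i in [set: 'I_m]) halfspace (a i) (b i).

(** n-dimensional Lebesgue integral of a nonnegative extended-real function,
    computed as the iterated (Tonelli) integral of one-dimensional Lebesgue
    integrals; the first coordinate is integrated last. *)
Fixpoint iter_integral (n : nat) : ('rV[R]_n -> \bar R) -> \bar R :=
  match n return ('rV[R]_n -> \bar R) -> \bar R with
  | 0 => fun f => f 0
  | k.+1 => fun f =>
      (\int[@lebesgue_measure R]_(x in [set: R])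
          iter_integral (fun v : 'rV[R]_k => f (row_mx (\row_(j < 1) x) v)))%E
  end.

Definition vol (n : nat) (S : set 'rV[R]_n) : \bar R :=
  iter_integral (fun x => (\1_S x)%:E).

(** V_{P,p0,n}(r) = 0 for r < 0, Vol_n[P ∩ B_n(p0, r)] for r >= 0
    (this volume is finite since the set is bounded). *)
Definition Vfun (n : nat) (P : set 'rV[R]_n) (p0 : 'rV[R]_n) (r : R) : R :=
  if r < 0 then 0 else fine (vol (P `&` cball p0 r)).

(* Main.v *)
(* Products of indicators of halfspaces reduce to translated cones.  If the
   hyperplanes [a_i . p = b_i] have no common point, the Fredholm alternative
   gives [c] with [sum c_i a_i = 0] and [sum c_i b_i < 0]; then no point lies
   in all [H_i] with [0 <= c_i] and outside all [H_i] with [c_i < 0].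
   Expanding the vanishing product of the [1_{H_i}] and [1 - 1_{H_i}] writes
   the indicator of the intersection as an integer combination of indicators
   of intersections of fewer halfspaces.

   For a cone [C] with apex at [q] from the centre, integrate [n t^(n-1) 1(t
   x in C, |t x + q| <= r) 1(1 <= |x| <= 2) / |x|] over [t > 0] and [x] in
   both orders.  Integrating [t] first gives [rho^n], where [rho (x, r) = (s
   + sqrt (r^2 - d)) / |x|] is the length of the ray through [x], [s = - q.x
   / |x|] and [d = |q|^2 - s^2]; substituting [y = t x] first gives [n / 2]
   times the volume.  So the volume is an integral over a bounded shell of
   [rho^n], and the binomial theorem together with the power series of [(1 -
   d / r^2)^(j/2)], integrated termwise, gives the expansion at infinity. *)

Require Import Defs.
From Stdlib Require Import Reals Lra Lia ClassicalEpsilon.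
From Coquelicot Require Import Coquelicot.

(** * Holomorphic functions near infinity *)

Section ComplexAnalysis.
Local Open Scope R_scope.
Local Notation CC := (AbsRing_NormedModule C_AbsRing).

(** A cone helps because every ray from its apex stays in the cone or misses it, and once the apex
    is inside the ball each ray leaves the ball exactly once, at a distance given by one quadratic
    formula; in a general polyhedron the facets would cut the rays as well. The shell stands in for
    the unit sphere: averaging over radii between 1 and 2 keeps everything a Lebesgue integral on
    the whole space, with no surface measure. Termwise integration needs no convergence theorem for
    integrals: [d] is at most [|q|^2], so for large [r] the partial sums of the binomial series have
    an error [(1/2)^N] uniform in [x], and integrating finite sums preserves such a bound. The
    series involves only powers of [1 / r^2]; each binomial term is [r^j], with [j <= n], times such
    a series, which bounds the order of the pole by [n]. *)

Lemma is_derive_C_eps (F : C -> C) (z l : C) :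
  (forall eps, 0 < eps -> exists delta, 0 < delta /\
     forall w : C, Cmod (w - z) < delta ->
       Cmod (F w - F z - (w - z) * l)%C <= eps * Cmod (w - z)) ->
  @is_derive C_AbsRing CC F z l.
Proof.
intros H; split; [apply is_linear_scal_l|].
intros x Hx eps.
rewrite <- (@is_filter_lim_locally_unique C_AbsRing CC z x Hx); clear x Hx.
destruct (H eps (cond_pos eps)) as [d [d0 Hd]].
exists (mkposreal d d0); intros y Hy; exact (Hd y Hy).
Qed.

(** The product rule [is_derive_mult] lives on [CC], while the theorem speaks of [C_NormedModule];
    the little-o conditions of the two structures are convertible. *)
Lemma ex_derive_C_NormedModule (F : C -> C) (z : C) :
  @ex_derive C_AbsRing CC F z <-> @ex_derive C_AbsRing C_NormedModule F z.
Proof.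
split; intros [l [_ H]]; exists l; split; [apply is_linear_scal_l|exact H|
  apply is_linear_scal_l|exact H].
Qed.

Lemma is_derive_Cinv (z : C) : z <> 0 ->
  @is_derive C_AbsRing CC Cinv z (- / (z * z))%C.
Proof.
intros Hz; apply is_derive_C_eps; intros eps He.
assert (Hm : 0 < Cmod z) by (apply Cmod_gt_0; exact Hz).
set (m := Cmod z) in *.
assert (H3 : 0 < eps * m ^ 3 / 2).
{ apply Rdiv_lt_0_compat; [apply Rmult_lt_0_compat; [lra|apply pow_lt; lra]|lra]. }
(* The first bound keeps [|w| > m / 2]; the remainder [(w - z)^2 / (w z^2)] is then at most
   [2 |w - z|^2 / m^3], whence the second. *)
exists (Rmin (m / 2) (eps * m ^ 3 / 2)); split.
{ apply Rmin_glb_lt; lra. }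
intros w Hw.
assert (Hw1 : Cmod (w - z) < m / 2) by (eapply Rlt_le_trans; [exact Hw|apply Rmin_l]).
assert (Hw2 : Cmod (w - z) < eps * m ^ 3 / 2) by (eapply Rlt_le_trans; [exact Hw|apply Rmin_r]).
assert (Hwm : m / 2 < Cmod w).
{ assert (T := Cmod_triangle w (- (w - z))).
  replace (w + - (w - z))%C with z in T by ring.
  rewrite Cmod_opp in T; fold m in T; lra. }
assert (Hw0 : w <> 0) by (apply Cmod_gt_0; lra).
replace (/ w - / z - (w - z) * - / (z * z))%C
  with ((w - z) * ((w - z) * / (w * (z * z))))%C by (field; split; assumption).
assert (Hwzz : (w * (z * z))%C <> 0) by (repeat apply Cmult_neq_0; assumption).
rewrite !Cmod_mult, Cmod_inv, !Cmod_mult, Rmult_comm by assumption.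
fold m.
apply Rmult_le_compat_r; [apply Cmod_ge_0|].
assert (Hp : 0 < m * m) by (apply Rmult_lt_0_compat; lra).
apply Rle_trans with (eps * m ^ 3 / 2 * / (m / 2 * (m * m))).
- apply Rmult_le_compat.
  + apply Cmod_ge_0.
  + left; apply Rinv_0_lt_compat, Rmult_lt_0_compat; lra.
  + lra.
  + apply Rinv_le_contravar; [apply Rmult_lt_0_compat; lra|].
    apply Rmult_le_compat_r; lra.
- right; field; lra.
Qed.

(** * Power series with geometrically bounded coefficients *)

Lemma is_series_Cmod_le (a : nat -> C) (l : C) (c : R) :
  @is_series C_AbsRing CC a l ->
  (forall k, Cmod (a k) <= c * (1/2) ^ k) -> Cmod l <= 2 * c.
Proof.
intros Ha Hb.
assert (Hs : forall N, Cmod (@sum_n CC a N) <= 2 * c).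
{ intros N.
  assert (c0 : 0 <= c).
  { assert (T := Hb O); simpl in T; assert (T' := Cmod_ge_0 (a O)); lra. }
  (* The exact partial sum of the geometric majorant, since the bound [2 * c] alone is not
     inductive. *)
  assert (Hn : Cmod (@sum_n CC a N) <= c * (2 - (1/2) ^ N)).
  { induction N as [|N IH].
    - rewrite sum_O; generalize (Hb O); simpl; lra.
    - rewrite sum_Sn.
      eapply Rle_trans; [apply Cmod_triangle|].
      generalize (Hb (S N)); simpl; lra. }
  assert (0 < (1/2) ^ N) by (apply pow_lt; lra).
  nra. }
apply (@closed_filterlim nat R_UniformSpace eventually _
  (fun N => @norm C_AbsRing CC (sum_n a N)) (fun x => x <= 2 * c) (Cmod l)).
- apply (filterlim_comp _ _ _ _ _ _ _ _ Ha (filterlim_norm (l : CC))).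
- exact Hs.
- apply closed_le.
Qed.

Lemma INR_lt_pow2 (k : nat) : INR k <= 2 ^ k.
Proof.
induction k as [|k IH]; [simpl; lra|].
rewrite S_INR; simpl; assert (1 <= 2 ^ k) by (apply pow_R1_Rle; lra); lra.
Qed.

(** The factor [rho ^ 2] on the left clears the power [rho ^ (k - 2)] of the natural bound, awkward
    for [k < 2]; the sharp constant [k (k - 1) / 2] is relaxed to [k ^ 2]. *)
Lemma Cpow_taylor1 (v w : C) (rho : R) (k : nat) :
  Cmod v <= rho -> Cmod w <= rho ->
  rho ^ 2 * Cmod (v ^ k - w ^ k - INR k * w ^ pred k * (v - w))%C
    <= INR k ^ 2 * rho ^ k * Cmod (v - w) ^ 2.
Proof.
intros Hv Hw.
assert (r0 : 0 <= rho) by (eapply Rle_trans; [apply Cmod_ge_0|exact Hv]).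
induction k as [|k IH].
{ replace (v ^ 0 - w ^ 0 - INR 0 * w ^ pred 0 * (v - w))%C with (RtoC 0)
    by (simpl; ring).
  rewrite Cmod_0; simpl; lra. }
set (e := (v ^ k - w ^ k - INR k * w ^ pred k * (v - w))%C) in *.
assert (E : (v ^ S k - w ^ S k - INR (S k) * w ^ pred (S k) * (v - w))%C =
  (v * e + INR k * w ^ pred k * ((v - w) * (v - w)))%C).
{ unfold e; rewrite S_INR, RtoC_plus; destruct k as [|k]; simpl; ring. }
rewrite E; clear E.
assert (Hk : rho * Cmod (w ^ pred k) * INR k <= rho ^ k * INR k).
{ destruct k as [|k]; [simpl; lra|].
  apply Rmult_le_compat_r; [apply pos_INR|].
  simpl pred; rewrite Cmod_pow; simpl.
  apply Rmult_le_compat_l; [lra|]; apply pow_incr; split; [apply Cmod_ge_0|exact Hw]. }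
set (h := Cmod (v - w)) in *.
assert (h0 : 0 <= h) by apply Cmod_ge_0.
eapply Rle_trans.
{ apply Rmult_le_compat_l; [nra|apply Cmod_triangle]. }
rewrite !Cmod_mult, Cmod_R, (Rabs_pos_eq (INR k)) by apply pos_INR.
fold h.
assert (p0 := pow_le rho k r0).
assert (k0 := pos_INR k).
assert (H1 : Cmod v * (rho ^ 2 * Cmod e) <= rho * (INR k ^ 2 * rho ^ k * h ^ 2)).
{ apply Rmult_le_compat; [apply Cmod_ge_0| |exact Hv|exact IH].
  apply Rmult_le_pos; [nra|apply Cmod_ge_0]. }
assert (H2 : rho * (h ^ 2) * (rho * Cmod (w ^ pred k) * INR k)
   <= rho * (h ^ 2) * (rho ^ k * INR k)).
{ apply Rmult_le_compat_l; [|exact Hk]. apply Rmult_le_pos; [lra|nra]. }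
rewrite S_INR; simpl.
assert (H3 : 0 <= rho * rho ^ k * (h * h) * (INR k + 1)).
{ repeat apply Rmult_le_pos; lra. }
simpl in H1, H2. nra.
Qed.

(* The radius 1/(8K), smaller than necessary, gives the geometric majorant
   (1/2)^k even after the factor k^2 <= 4^k. *)
Lemma power_series_holomorphic (A : nat -> R) (M K : R) :
  0 < K -> (forall k, Rabs (A k) <= M * K ^ k) ->
  exists G : C -> C,
    (forall w : C, Cmod w < / (8 * K) ->
       @is_series C_AbsRing CC (fun k => (A k * w ^ k)%C) (G w)) /\
    (forall w : C, Cmod w < / (8 * K) -> @ex_derive C_AbsRing CC G w).
Proof.
intros K0 HA.
assert (M0 : 0 <= M).
{ generalize (HA O) (Rabs_pos (A O)); simpl; lra. }
set (rho := / (8 * K)).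
assert (r0 : 0 < rho) by (apply Rinv_0_lt_compat; lra).
assert (HKr : forall k, (K ^ k) * rho ^ k * 4 ^ k = (1/2) ^ k).
{ intros k; rewrite <- !Rpow_mult_distr; f_equal; unfold rho; field; lra. }
assert (g2 : ex_series (fun k => (1/2) ^ k)).
{ exists (/ (1 - 1/2)); apply is_series_geom; rewrite Rabs_pos_eq; lra. }
assert (Hex : forall a : nat -> C, forall c,
  (forall k, Cmod (a k) <= c * (1/2) ^ k) -> @ex_series C_AbsRing CC a).
{ intros a c Ha.
  destruct (@ex_series_le C_AbsRing C_CompleteNormedModule a
    (fun k => c * (1/2) ^ k)) as [l Hl].
  - exact Ha.
  - exact (@ex_series_scal R_AbsRing R_NormedModule c _ g2).
  - exists l. intros P HP. apply Hl. apply locally_C. exact HP. }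
assert (Hterm : forall w : C, Cmod w < rho -> forall k,
   Cmod (A k * w ^ k)%C <= M * (1/2) ^ k).
{ intros w Hw k; rewrite Cmod_mult, Cmod_R, Cmod_pow.
  rewrite <- HKr.
  assert (1 <= 4 ^ k) by (apply pow_R1_Rle; lra).
  assert (0 <= K ^ k) by (apply pow_le; lra).
  assert (0 <= rho ^ k) by (apply pow_le; lra).
  assert (Cmod w ^ k <= rho ^ k) by (apply pow_incr; split; [apply Cmod_ge_0|lra]).
  apply Rle_trans with (M * K ^ k * rho ^ k).
  - apply Rmult_le_compat; [apply Rabs_pos|apply pow_le, Cmod_ge_0|apply HA|assumption].
  - assert (0 <= M * K ^ k * rho ^ k).
    { repeat apply Rmult_le_pos; assumption. }
    nra. }
(* The condition on [|w|] sits inside the existential, so that choice yields a total function;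
   outside the disc its values are arbitrary. *)
assert (HG : forall w : C, exists g : C, Cmod w < rho ->
   @is_series C_AbsRing CC (fun k => (A k * w ^ k)%C) g).
{ intros w; destruct (Rlt_dec (Cmod w) rho) as [Hw|Hw].
  - destruct (Hex _ _ (Hterm w Hw)) as [g Hg]; exists g; intros _; exact Hg.
  - exists (RtoC 0); intros H; contradiction. }
set (G := fun w => proj1_sig (constructive_indefinite_description _ (HG w))).
assert (HGs : forall w : C, Cmod w < rho ->
   @is_series C_AbsRing CC (fun k => (A k * w ^ k)%C) (G w)).
{ intros w; exact (proj2_sig (constructive_indefinite_description _ (HG w))). }
exists G; split; [exact HGs|].
intros w Hw.
assert (Hd : forall k, Cmod (A k * (INR k * w ^ pred k))%C <= (M / rho) * (1/2) ^ k).
{ intros k; rewrite !Cmod_mult, !Cmod_R, Cmod_pow, (Rabs_pos_eq (INR k)) by apply pos_INR.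
  rewrite <- HKr.
  assert (0 <= K ^ k) by (apply pow_le; lra).
  assert (0 <= rho ^ k) by (apply pow_le; lra).
  apply Rle_trans with ((M * K ^ k) * (4 ^ k * (rho ^ k / rho))).
  2: { right; field; lra. }
  apply Rmult_le_compat; [apply Rabs_pos| |apply HA|].
  { apply Rmult_le_pos; [apply pos_INR|apply pow_le, Cmod_ge_0]. }
  destruct k as [|k].
  { simpl. rewrite Rmult_0_l. apply Rmult_le_pos; [lra|].
    apply Rmult_le_pos; [lra|left; apply Rinv_0_lt_compat; lra]. }
  apply Rmult_le_compat; [apply pos_INR|apply pow_le, Cmod_ge_0| |].
  - eapply Rle_trans; [apply INR_lt_pow2|]. apply pow_incr; lra.
  - replace (rho ^ S k / rho) with (rho ^ k) by (simpl; field; lra).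
    apply pow_incr; split; [apply Cmod_ge_0|lra]. }
destruct (Hex _ _ Hd) as [D HD].
exists D.
apply is_derive_C_eps; intros eps He.
(* The constant in [|G v - G w - (v - w) D| <= B |v - w|^2]: the 2 sums the geometric series, and
   [M / rho ^ 2] comes from [Cpow_taylor1]. Dividing by [B + 1] below allows [B = 0]. *)
set (B := 2 * (M / rho ^ 2)).
assert (B0 : 0 <= B).
{ unfold B; apply Rmult_le_pos; [lra|]; apply Rmult_le_pos; [lra|].
  left; apply Rinv_0_lt_compat; apply pow_lt; lra. }
exists (Rmin (rho - Cmod w) (eps / (B + 1))); split.
{ apply Rmin_glb_lt; [lra|]; apply Rdiv_lt_0_compat; lra. }
intros v Hv.
assert (Hv1 : Cmod (v - w) < rho - Cmod w) by (eapply Rlt_le_trans; [exact Hv|apply Rmin_l]).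
assert (Hv2 : Cmod (v - w) < eps / (B + 1)) by (eapply Rlt_le_trans; [exact Hv|apply Rmin_r]).
assert (Hvr : Cmod v < rho).
{ assert (T := Cmod_triangle w (v - w)).
  replace (w + (v - w))%C with v in T by ring; lra. }
set (h := Cmod (v - w)) in *.
assert (h0 : 0 <= h) by apply Cmod_ge_0.
apply Rle_trans with (2 * (M / rho ^ 2 * h ^ 2)).
- apply is_series_Cmod_le with
   (fun k => (A k * v ^ k - A k * w ^ k - (v - w) * (A k * (INR k * w ^ pred k)))%C).
  + apply (@is_series_minus C_AbsRing CC _ _ (G v - G w)%C ((v - w) * D)%C).
    * apply (@is_series_minus C_AbsRing CC _ _ (G v) (G w)); apply HGs; assumption.
    * apply (@is_series_scal C_AbsRing CC (v - w)%C); exact HD.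
  + intros k.
    replace (A k * v ^ k - A k * w ^ k - (v - w) * (A k * (INR k * w ^ pred k)))%C
      with (A k * (v ^ k - w ^ k - INR k * w ^ pred k * (v - w)))%C by ring.
    rewrite Cmod_mult, Cmod_R, <- HKr.
    set (e := Cmod _).
    assert (He' : rho ^ 2 * e <= INR k ^ 2 * rho ^ k * h ^ 2)
      by (apply Cpow_taylor1; lra).
    assert (e0 : 0 <= e) by apply Cmod_ge_0.
    assert (p2 : 0 < rho ^ 2) by (apply pow_lt; lra).
    assert (He2 : e <= 4 ^ k * rho ^ k * h ^ 2 / rho ^ 2).
    { apply Rmult_le_reg_l with (rho ^ 2); [exact p2|].
      replace (rho ^ 2 * (4 ^ k * rho ^ k * h ^ 2 / rho ^ 2))
        with (4 ^ k * rho ^ k * h ^ 2) by (field; lra).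
      eapply Rle_trans; [exact He'|].
      apply Rmult_le_compat_r; [nra|].
      apply Rmult_le_compat_r; [apply pow_le; lra|].
      replace (4 ^ k) with ((2 ^ k) ^ 2).
      - apply pow_incr; split; [apply pos_INR|apply INR_lt_pow2].
      - rewrite <- pow_mult, Nat.mul_comm, pow_mult; f_equal; lra. }
    apply Rle_trans with (M * K ^ k * (4 ^ k * rho ^ k * h ^ 2 / rho ^ 2)).
    * apply Rmult_le_compat; [apply Rabs_pos|exact e0|apply HA|exact He2].
    * right; field; lra.
- replace (2 * (M / rho ^ 2 * h ^ 2)) with (B * h * h) by (unfold B; field; lra).
  apply Rmult_le_compat_r; [exact h0|].
  apply Rle_trans with ((B + 1) * (eps / (B + 1))); [nra|right; field; lra].
Qed.

(** * Real functions extending meromorphically to infinity *)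

(** The conclusion of the theorem for an arbitrary [V], so that closure properties can be proved;
    the order of the pole is encoded as growth at most [|z|^n]. *)
Definition meromorphic_at_infinity (n : nat) (V : R -> R) : Prop :=
  exists (rad : R) (F : C -> C),
    0 < rad /\
    (forall z : C, rad < Cmod z -> @ex_derive C_AbsRing C_NormedModule F z) /\
    (exists M R1 : R, forall z : C, R1 < Cmod z ->
        Cmod (F z) <= M * Cmod z ^ n) /\
    (forall r : R, rad < r -> F (RtoC r) = RtoC (V r)).

Lemma meromorphic_at_infinity_ext (n : nat) (V W : R -> R) (r0 : R) :
  (forall r, r0 < r -> V r = W r) ->
  meromorphic_at_infinity n V -> meromorphic_at_infinity n W.
Proof.
intros H [rad [F [h0 [h1 [h2 h3]]]]].
exists (Rmax rad r0), F; repeat split.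
- eapply Rlt_le_trans; [exact h0|apply Rmax_l].
- intros z Hz; apply h1; eapply Rle_lt_trans; [apply Rmax_l|exact Hz].
- exact h2.
- intros r Hr; rewrite <- H; [apply h3|]; eapply Rle_lt_trans; try exact Hr;
    [apply Rmax_l|apply Rmax_r].
Qed.

Lemma meromorphic_at_infinity_const (n : nat) (c : R) :
  meromorphic_at_infinity n (fun _ => c).
Proof.
exists 1, (fun _ => RtoC c); repeat split; try lra.
- intros z _; apply ex_derive_const.
- exists (Rabs c), 1; intros z Hz; rewrite Cmod_R.
  assert (1 <= Cmod z ^ n) by (apply pow_R1_Rle; lra).
  generalize (Rabs_pos c); nra.
Qed.

Lemma meromorphic_at_infinity_lin (n : nat) (a : R) (V W : R -> R) :
  meromorphic_at_infinity n V -> meromorphic_at_infinity n W ->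
  meromorphic_at_infinity n (fun r => V r + a * W r).
Proof.
intros [rad [F [h0 [h1 [[M [R1 h2]] h3]]]]] [rad' [F' [h0' [h1' [[M' [R1' h2']] h3']]]]].
exists (Rmax rad rad'), (fun z => (F z + a * F' z)%C); repeat split.
- eapply Rlt_le_trans; [exact h0|apply Rmax_l].
- intros z Hz.
  apply (@ex_derive_plus C_AbsRing C_NormedModule F (fun z => a * F' z)%C).
  + apply h1; eapply Rle_lt_trans; [apply Rmax_l|exact Hz].
  + assert (Hd : @ex_derive C_AbsRing C_NormedModule F' z).
    { apply h1'; eapply Rle_lt_trans; [apply Rmax_r|exact Hz]. }
    apply ex_derive_C_NormedModule in Hd; destruct Hd as [l Hl].
    apply ex_derive_C_NormedModule; eexists.
    apply (@is_derive_mult C_AbsRing (fun _ => RtoC a) F' z (RtoC 0) l).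
    * apply @is_derive_const.
    * exact Hl.
    * intros u v; apply Cmult_comm.
- exists (M + Rabs a * M'), (Rmax R1 R1'); intros z Hz.
  eapply Rle_trans; [apply Cmod_triangle|].
  rewrite Rmult_plus_distr_r; apply Rplus_le_compat.
  + apply h2; eapply Rle_lt_trans; [apply Rmax_l|exact Hz].
  + rewrite Cmod_mult, Cmod_R, Rmult_assoc; apply Rmult_le_compat_l; [apply Rabs_pos|].
    apply h2'; eapply Rle_lt_trans; [apply Rmax_r|exact Hz].
- intros r Hr; rewrite h3, h3', RtoC_plus, RtoC_mult; [reflexivity| |];
  (eapply Rle_lt_trans; [|exact Hr]); [apply Rmax_r|apply Rmax_l].
Qed.

Lemma meromorphic_at_infinity_series (n j : nat) (A : nat -> R) (M K r0 : R)
    (V : R -> R) :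
  (j <= n)%nat -> 0 < K -> (forall k, Rabs (A k) <= M * K ^ k) ->
  (forall r, r0 < r -> is_series (fun k => A k * (/ (r * r)) ^ k) (V r)) ->
  meromorphic_at_infinity n (fun r => r ^ j * V r).
Proof.
intros Hj K0 HA HV.
destruct (power_series_holomorphic A M K K0 HA) as [G [HG HdG]].
set (rho := / (8 * K)) in *.
(* From [|z| > 1] follow [|z|^j <= |z|^n] and [|z|^2 > |z| > 8 K], which puts [1 / z^2] in the disc
   of convergence; the last summand forces [r > r0]. *)
set (rad := 1 + 8 * K + Rabs r0).
assert (Hr0 : r0 <= Rabs r0) by apply Rle_abs.
assert (Hr0' := Rabs_pos r0).
assert (r1 : 1 < rad) by (unfold rad; lra).
assert (Hsm : forall z : C, rad < Cmod z -> Cmod (/ (z * z)) < rho).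
{ intros z Hz.
  assert (z0 : z <> 0) by (apply Cmod_gt_0; lra).
  rewrite Cmod_inv, Cmod_mult by (apply Cmult_neq_0; exact z0).
  apply Rinv_lt_contravar.
  - apply Rmult_lt_0_compat; [lra|]; apply Rmult_lt_0_compat; lra.
  - unfold rad in Hz; nra. }
exists rad, (fun z => z ^ j * G (/ (z * z)))%C; repeat split.
- lra.
- intros z Hz; apply ex_derive_C_NormedModule.
  assert (z0 : z <> 0) by (apply Cmod_gt_0; lra).
  assert (Hm : forall n m : C_AbsRing, mult n m = mult m n) by (intros; apply Cmult_comm).
  assert (H1 : forall i, @ex_derive C_AbsRing CC (fun z : C => z ^ i)%C z).
  { intros i; induction i as [|i [l IH]].
    - exact (@ex_derive_const C_AbsRing CC (RtoC 1) z).
    - eexists; apply (@is_derive_mult C_AbsRing (fun z => z) (fun z : C => z ^ i)%C).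
      + apply is_derive_id.
      + exact IH.
      + exact Hm. }
  assert (H2 : @ex_derive C_AbsRing CC (fun z : C => / (z * z))%C z).
  { apply (@ex_derive_comp C_AbsRing CC Cinv (fun z : C => z * z)%C).
    - eexists; apply is_derive_Cinv; apply Cmult_neq_0; exact z0.
    - eexists; apply (@is_derive_mult C_AbsRing (fun z => z) (fun z => z));
        [apply is_derive_id|apply is_derive_id|exact Hm]. }
  destruct (H1 j) as [l1 D1].
  destruct (@ex_derive_comp C_AbsRing CC G (fun z : C => / (z * z))%C z
    (HdG _ (Hsm z Hz)) H2) as [l2 D2].
  eexists; apply (@is_derive_mult C_AbsRing (fun z : C => z ^ j)%C _ _ _ _ D1 D2 Hm).
- exists (2 * M), rad; intros z Hz.
  rewrite Cmod_mult, Cmod_pow, Rmult_comm.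
  assert (Hs := Hsm z Hz).
  apply Rmult_le_compat; [apply Cmod_ge_0|apply pow_le, Cmod_ge_0| |].
  + apply is_series_Cmod_le with (1 := HG _ Hs).
    intros k; rewrite Cmod_mult, Cmod_R, Cmod_pow.
    assert (Hw := Cmod_ge_0 (/ (z * z))).
    apply Rle_trans with ((M * K ^ k) * rho ^ k).
    * apply Rmult_le_compat; [apply Rabs_pos|apply pow_le; exact Hw|apply HA|].
      apply pow_incr; lra.
    * rewrite Rmult_assoc, <- Rpow_mult_distr.
      apply Rmult_le_compat_l.
      { generalize (HA O) (Rabs_pos (A O)); simpl; lra. }
      replace (K * rho) with (1 / 8) by (unfold rho; field; lra).
      apply pow_incr; lra.
  + apply Rle_pow; [lra|exact Hj].
- intros r Hr.
  assert (rp : 0 < r) by lra.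
  assert (Hz : rad < Cmod (RtoC r)) by (rewrite Cmod_R, Rabs_pos_eq; lra).
  rewrite RtoC_mult, RtoC_pow; f_equal.
  assert (rr : r * r <> 0) by nra.
  assert (E : (/ (r * r))%C = RtoC (/ (r * r))).
  { rewrite <- RtoC_mult, <- RtoC_inv by exact rr; reflexivity. }
  assert (HS := HG _ (Hsm r Hz)); rewrite E in HS |- *.
  (* The real series, read in [C], also sums to [V r]; uniqueness of limits then identifies [G] with
     [V] on the real axis. *)
  assert (HS2 : @is_series C_AbsRing CC (fun k => (A k * (RtoC (/ (r * r))) ^ k)%C) (RtoC (V r))).
  { intros P [eps HP].
    destruct (HV r ltac:(unfold rad in Hr; lra) (fun x => Rabs (x - V r) < eps)) as [N HN].
    { exists eps; intros y Hy; exact Hy. }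
    exists N; intros m Hm; apply HP.
    specialize (HN m Hm).
    assert (Hsum : @sum_n CC (fun k => (A k * (RtoC (/ (r * r))) ^ k)%C) m =
       RtoC (sum_n (fun k => A k * (/ (r * r)) ^ k) m)).
    { clear; induction m as [|m IH].
      - rewrite !sum_O, RtoC_mult, RtoC_pow; reflexivity.
      - rewrite !sum_Sn, IH, <- RtoC_pow, <- RtoC_mult.
        symmetry; apply RtoC_plus. }
    rewrite Hsum.
    set (S := sum_n (fun k => A k * (/ (r * r)) ^ k) m) in *.
    change (Cmod (RtoC S - RtoC (V r)) < eps).
    rewrite <- RtoC_minus, Cmod_R; exact HN. }
  apply (filterlim_locally_unique (V := CC) (F := eventually) _ _ _ HS HS2).
Qed.

(** * The binomial series for powers of a square root *)

(* Coefficients of [(1 - u) ^ alpha]. *)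
Fixpoint binomial_coef (alpha : R) (k : nat) : R :=
  match k with
  | O => 1
  | S k => binomial_coef alpha k * (INR k - alpha) / (INR k + 1)
  end.

(** Each factor [(k - alpha) / (k + 1)] of the recursion is at most [1 + alpha] in absolute
    value. *)
Lemma binomial_coef_bound (alpha : R) (k : nat) :
  0 <= alpha -> Rabs (binomial_coef alpha k) <= (1 + alpha) ^ k.
Proof.
intros a0; induction k as [|k IH]; simpl.
- rewrite Rabs_R1; lra.
- assert (k0 := pos_INR k).
  unfold Rdiv; rewrite !Rabs_mult, (Rabs_pos_eq (/ _)) by
    (left; apply Rinv_0_lt_compat; lra).
  rewrite Rmult_assoc, (Rmult_comm (1 + alpha)).
  apply Rmult_le_compat; [apply Rabs_pos| |exact IH|].
  + apply Rmult_le_pos; [apply Rabs_pos|left; apply Rinv_0_lt_compat; lra].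
  + apply Rmult_le_reg_r with (INR k + 1); [lra|].
    rewrite Rmult_assoc, Rinv_l, Rmult_1_r by lra.
    apply Rabs_le; nra.
Qed.

Lemma is_derive_sqrt_pow (j : nat) (x : R) : x < 1 ->
  is_derive (fun x => sqrt (1 - x) ^ j) x
    (- (INR j / 2) * sqrt (1 - x) ^ j / (1 - x)).
Proof.
intros Hx.
assert (H0 : 0 < sqrt (1 - x)) by (apply sqrt_lt_R0; lra).
assert (Hs : sqrt (1 - x) * sqrt (1 - x) = 1 - x) by (apply sqrt_sqrt; lra).
evar_last.
- apply (is_derive_pow (fun x => sqrt (1 - x)) j x (- / (2 * sqrt (1 - x)))).
  auto_derive; [lra|unfold Rminus in *; field; lra].
- set (q := sqrt (1 - x)) in *; rewrite <- Hs.
  destruct j as [|j]; [simpl; field; lra|].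
  simpl pred; rewrite <- tech_pow_Rmult; field; lra.
Qed.

(* Both sides solve [(1 - u) y' = - (j / 2) y], so their quotient is constant. *)
Lemma sqrt_pow_series (j : nat) (u : R) :
  Rabs u < / (1 + INR j / 2) ->
  is_series (fun k => binomial_coef (INR j / 2) k * u ^ k) (sqrt (1 - u) ^ j).
Proof.
set (alpha := INR j / 2); set (b := binomial_coef alpha).
assert (a0 : 0 <= alpha) by (unfold alpha; generalize (pos_INR j); lra).
set (rho := / (1 + alpha)).
assert (rp : 0 < rho) by (apply Rinv_0_lt_compat; lra).
assert (r1 : rho <= 1).
{ unfold rho; rewrite <- Rinv_1; apply Rinv_le_contravar; lra. }
assert (Hcv : forall x, Rabs x < rho -> Rbar_lt (Rabs x) (CV_radius b)).
{ intros x Hx.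
  apply Rbar_lt_le_trans with rho; [exact Hx|].
  apply (CV_radius_bounded b); exists 1; intros k.
  rewrite Rabs_mult, <- RPow_abs, (Rabs_pos_eq rho) by lra.
  replace 1 with ((1 + alpha) ^ k * rho ^ k).
  - apply Rmult_le_compat_r; [apply pow_le; lra|].
    apply binomial_coef_bound; exact a0.
  - rewrite <- Rpow_mult_distr; unfold rho.
    rewrite Rinv_r by lra; apply pow1. }
assert (Hser : forall x, Rabs x < rho -> ex_pseries b x).
{ intros x Hx; apply CV_radius_inside, Hcv, Hx. }
set (S := PSeries b).
assert (HdS : forall x, Rabs x < rho ->
   is_derive S x (- alpha * S x / (1 - x))).
{ intros x Hx.
  assert (x1 : x < 1) by (apply Rabs_lt_between in Hx; lra).
  assert (Hd : is_derive S x (PSeries (PS_derive b) x))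
    by (apply is_derive_PSeries, Hcv, Hx).
  assert (Hex : ex_pseries (PS_derive b) x).
  { apply CV_radius_inside; rewrite CV_radius_derive; apply Hcv, Hx. }
  evar_last; [exact Hd|].
  (* The differential equation, coefficient by coefficient: that of [x^k] in [(1 - x) S'] is
     [(k + 1) b_(k+1) - k b_k], and the recursion turns it into [- alpha b_k]. *)
  assert (E : PSeries (PS_derive b) x - x * PSeries (PS_derive b) x = - alpha * S x).
  { rewrite <- PSeries_incr_1, <- PSeries_minus.
    - unfold S; rewrite <- PSeries_scal; apply PSeries_ext; intros k.
      unfold PS_minus, PS_opp, PS_plus, PS_scal, PS_incr_1, PS_derive.
      destruct k as [|k].
      + change (INR 1 * (1 * (INR 0 - alpha) / (INR 0 + 1)) + - 0 = - alpha * 1).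
        simpl; field.
      + set (m := Datatypes.S k).
        change (INR (Datatypes.S m) * (b m * (INR m - alpha) / (INR m + 1))
           + - (INR m * b m) = - alpha * b m).
        assert (m0 := pos_INR m); rewrite S_INR; field; lra.
    - exact Hex.
    - apply ex_pseries_incr_1; exact Hex. }
  apply Rmult_eq_reg_r with (1 - x); [|lra].
  replace (- alpha * S x / (1 - x) * (1 - x)) with (- alpha * S x) by (field; lra).
  lra. }
assert (Hg : forall x, Rabs x < rho ->
  is_derive (fun x => S x / sqrt (1 - x) ^ j) x 0).
{ intros x Hx.
  assert (x1 : x < 1) by (apply Rabs_lt_between in Hx; lra).
  assert (p0 : 0 < sqrt (1 - x) ^ j) by (apply pow_lt, sqrt_lt_R0; lra).
  evar_last.
  - apply is_derive_div; [apply HdS, Hx|apply is_derive_sqrt_pow; exact x1|lra].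
  - fold alpha; set (q := sqrt (1 - x) ^ j) in *; clearbody q; cbv beta; field; lra. }
intros Hu.
assert (S0 : S 0 = 1) by (unfold S; rewrite PSeries_0; reflexivity).
assert (Hconst : S u / sqrt (1 - u) ^ j = 1).
{ assert (E0 : S 0 / sqrt (1 - 0) ^ j = 1).
  { rewrite S0, Rminus_0_r, sqrt_1, pow1; field. }
  destruct (Rtotal_order u 0) as [Hlt|[->|Hgt]].
  - eapply eq_trans; [|exact E0].
    apply (eq_is_derive (fun x => S x / sqrt (1 - x) ^ j) u 0); [|exact Hlt].
    intros t Ht; apply Hg, Rabs_lt_between.
    apply Rabs_lt_between in Hu; lra.
  - exact E0.
  - eapply eq_trans; [symmetry|exact E0].
    apply (eq_is_derive (fun x => S x / sqrt (1 - x) ^ j) 0 u); [|exact Hgt].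
    intros t Ht; apply Hg, Rabs_lt_between.
    apply Rabs_lt_between in Hu; lra. }
assert (u1 : u < 1) by (apply Rabs_lt_between in Hu; lra).
assert (p0 : 0 < sqrt (1 - u) ^ j) by (apply pow_lt, sqrt_lt_R0; lra).
replace (sqrt (1 - u) ^ j) with (S u).
- apply is_pseries_R, PSeries_correct, Hser, Hu.
- apply Rmult_eq_reg_r with (/ sqrt (1 - u) ^ j);
    [|apply Rinv_neq_0_compat; lra].
  rewrite Rinv_r by lra; exact Hconst.
Qed.

(** * Geometric error bounds for partial sums *)

Lemma is_series_geometric_error (a : nat -> R) (l D : R) :
  (forall N, Rabs (l - sum_f_R0 a N) <= D * (1/2) ^ N) -> is_series a l.
Proof.
intros H; apply is_lim_seq_Reals.
intros eps He.
assert (D0 : 0 <= D).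
{ generalize (H O) (Rabs_pos (l - sum_f_R0 a 0)); simpl; lra. }
destruct (pow_lt_1_zero (1/2) ltac:(rewrite Rabs_pos_eq; lra) (eps / (D + 1))
  ltac:(apply Rdiv_lt_0_compat; lra)) as [N HN].
exists N; intros k Hk; unfold Rdist.
rewrite sum_n_Reals, <- Rabs_Ropp, Ropp_minus_distr.
eapply Rle_lt_trans; [apply H|].
specialize (HN k Hk).
rewrite Rabs_pos_eq in HN by (apply pow_le; lra).
apply Rle_lt_trans with ((D + 1) * (1/2) ^ k).
- apply Rmult_le_compat_r; [apply pow_le; lra|lra].
- replace eps with ((D + 1) * (eps / (D + 1))) by (field; lra).
  apply Rmult_lt_compat_l; lra.
Qed.

(** The sum of [(1/2)^k] over [k > N] is exactly [(1/2)^N]; [sum_f_R0 a N] includes the term of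
    index [N]. *)
Lemma is_series_geometric_tail (a : nat -> R) (l : R) :
  is_series a l -> (forall k, Rabs (a k) <= (1/2) ^ k) ->
  forall N, Rabs (l - sum_f_R0 a N) <= (1/2) ^ N.
Proof.
intros Ha Hb N.
assert (Hp : forall p, Rabs (sum_f_R0 a (N + p) - sum_f_R0 a N)
    <= (1/2) ^ N - (1/2) ^ (N + p)).
{ intros p; induction p as [|p IH].
  - rewrite Nat.add_0_r, !Rminus_diag, Rabs_R0; lra.
  - rewrite Nat.add_succ_r; simpl sum_f_R0.
    replace (sum_f_R0 a (N + p) + a (S (N + p)) - sum_f_R0 a N)
      with ((sum_f_R0 a (N + p) - sum_f_R0 a N) + a (S (N + p))) by ring.
    eapply Rle_trans; [apply Rabs_triang|].
    generalize (Hb (S (N + p))) IH; simpl; lra. }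
apply (@closed_filterlim_loc nat R_UniformSpace eventually _
  (sum_n a) (fun x => Rabs (x - sum_f_R0 a N) <= (1/2) ^ N) l Ha).
- exists N; intros k Hk.
  rewrite sum_n_Reals; replace k with (N + (k - N))%nat by lia.
  eapply Rle_trans; [apply Hp|].
  assert (0 < (1/2) ^ (N + (k - N))) by (apply pow_lt; lra); lra.
- apply (closed_comp (fun x => Rabs (x - sum_f_R0 a N)) (fun x => x <= (1/2) ^ N)).
  + intros x; apply (continuous_comp (fun x : R => x - sum_f_R0 a N) Rabs).
    * apply (continuous_minus (fun x : R => x) (fun _ => sum_f_R0 a N));
        [apply continuous_id|apply continuous_const].
    * apply continuous_Rabs.
  + apply closed_le.
Qed.

(** Half the radius of [sqrt_pow_series] dominates the terms by [(1/2)^k] for all admissible [u] at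
    once; this uniformity is what survives integration over [x]. *)
Lemma sqrt_pow_approx (j N : nat) (u : R) :
  Rabs u <= / (2 * (1 + INR j / 2)) ->
  Rabs (sqrt (1 - u) ^ j - sum_f_R0 (fun k => binomial_coef (INR j / 2) k * u ^ k) N)
    <= (1/2) ^ N.
Proof.
intros Hu; apply is_series_geometric_tail.
- apply sqrt_pow_series; eapply Rle_lt_trans; [exact Hu|].
  assert (j0 := pos_INR j).
  apply Rinv_lt_contravar; [apply Rmult_lt_0_compat; lra|lra].
- intros k; assert (j0 := pos_INR j).
  rewrite Rabs_mult, <- RPow_abs.
  replace ((1/2) ^ k) with ((1 + INR j / 2) ^ k * (/ (2 * (1 + INR j / 2))) ^ k).
  + apply Rmult_le_compat; [apply Rabs_pos|apply pow_le, Rabs_pos| |].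
    * apply binomial_coef_bound; lra.
    * apply pow_incr; split; [apply Rabs_pos|exact Hu].
  + rewrite <- Rpow_mult_distr; f_equal; field; lra.
Qed.

Lemma meromorphic_at_infinity_approx (n j : nat) (A : nat -> R) (M K r0 D : R)
    (V : R -> R) :
  (j <= n)%nat -> 0 < K -> (forall k, Rabs (A k) <= M * K ^ k) ->
  (forall r N, r0 < r ->
     Rabs (V r - sum_f_R0 (fun k => A k * (/ (r * r)) ^ k) N) <= D * (1/2) ^ N) ->
  meromorphic_at_infinity n (fun r => r ^ j * V r).
Proof.
intros Hj K0 HA HV.
apply (meromorphic_at_infinity_series n j A M K r0 V Hj K0 HA).
intros r Hr; apply is_series_geometric_error with D; intros N; apply HV; exact Hr.
Qed.

End ComplexAnalysis.

From HB Require Import structures.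
From mathcomp Require Import all_boot all_order all_algebra.
From mathcomp Require Import all_classical all_reals all_analysis.
From mathcomp Require Import measurable_realfun ring lra.
From mathcomp Require Import Rstruct Rstruct_topology.

Set Implicit Arguments.
Unset Strict Implicit.
Unset Printing Implicit Defensive.
Import Order.TTheory GRing.Theory Num.Theory.
Import numFieldNormedType.Exports.
Local Open Scope classical_set_scope.
Local Open Scope ring_scope.

(** * Iterated integrals *)

(** The recursion of [iter_integral] over an arbitrary [realType], so that the measure theory is
    independent of the concrete reals; [iter_integralE] identifies the two. *)
Fixpoint iter_int (R : realType) (n : nat) : ('rV[R]_n -> \bar R) -> \bar R :=
  match n return ('rV[R]_n -> \bar R) -> \bar R with
  | 0 => fun f => f 0
  | k.+1 => fun f =>
      (\int[@lebesgue_measure R]_(x in [set: R])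
          iter_int (fun v : 'rV[R]_k => f (row_mx (\row_(j < 1) x) v)))%E
  end.

Section IteratedIntegral.
Context {R : realType}.
Local Notation Rm := (measurableTypeR R).
Local Notation lambda := (@lebesgue_measure R).

(** The image of Lebesgue measure under the affine map, multiplied by [t], gives half-open intervals
    their length, hence is Lebesgue measure by uniqueness. *)
Lemma integral_affine (t a : R) (g : Rm -> \bar R) : 0 < t ->
  measurable_fun setT g -> (forall x, 0 <= g x)%E ->
  (\int[lambda]_x g (t * x + a)%R = (t^-1)%:E * \int[lambda]_x g x)%E.
Proof.
move=> t0 mg g0.
pose phi : Rm -> Rm := fun x => t * x + a.
have mphi : measurable_fun setT phi.
  by apply: measurable_funD => //; exact: measurable_funM.
have [pf pfE] : exists pf : {measure set Rm -> \bar R},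
    pf = pushforward lambda phi :> (set Rm -> \bar R).
  by unshelve eexists (pushforward lambda phi : measure _ _).
pose mu' := mscale (NngNum (ltW t0)) pf.
have lE (A : set Rm) : measurable A -> mu' A = lambda A.
  move=> mA; apply/esym/lebesgue_measure_unique => //= _ [[c e]] _ <-.
  rewrite /mu' /mscale/= pfE /pushforward.
  have -> : phi @^-1` `]c, e] = `](c - a) / t, (e - a) / t]%classic.
    apply/seteqP; split => x /=; rewrite !in_itv/= /phi;
      by rewrite ltr_pdivrMr// ler_pdivlMr// ltrBlDr lerBrDr mulrC.
  rewrite !lebesgue_measure_itv/= !lte_fin ltr_pM2r ?invr_gt0// ltrD2r.
  case: ifPn => // _; last by rewrite mule0.
  by rewrite -!EFinD -EFinM; congr EFin; field; rewrite gt_eqF.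
transitivity (\int[pf]_x g x)%E.
  by rewrite pfE ge0_integral_pushforward.
have -> : (\int[lambda]_x g x = \int[mu']_x g x)%E.
  by apply: eq_measure_integral => A mA _; exact/esym/lE.
rewrite ge0_integral_mscale//= muleA -EFinM mulVf ?mul1e// gt_eqF//.
Qed.

Definition coord_measurable d (Z : measurableType d) k (u : Z -> 'rV[R]_k) :=
  forall i, measurable_fun setT (fun z => u z ord0 i : Rm).

(* Measurability of [f] is tested along all coordinatewise measurable maps, so
   no sigma-algebra on ['rV[R]_k] is needed and closure under composition and
   slicing is immediate. *)
Definition param_measurable d' (T : measurableType d')
    d (Y : measurableType d) k (f : Y -> 'rV[R]_k -> T) :=
  forall d1 (Z : measurableType d1) (y : Z -> Y) (u : Z -> 'rV[R]_k),
    measurable_fun setT y -> coord_measurable u ->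
    measurable_fun setT (fun z => f (y z) (u z)).

Lemma row_cons_measurable d (Z : measurableType d) k (x : Z -> Rm)
    (u : Z -> 'rV[R]_k) :
  measurable_fun setT x -> coord_measurable u ->
  coord_measurable (fun z => row_mx (\row_(j < 1) x z) (u z)).
Proof.
move=> mx mu i; case: (splitP i) => j ij.
- have -> : i = lshift k j by apply/val_inj.
  by rewrite (_ : (fun z => _) = x)//; apply/funext => z; rewrite row_mxEl mxE.
- have -> : i = rshift 1 j by apply/val_inj.
  rewrite (_ : (fun z => _) = fun z => u z ord0 j); first exact: mu.
  by apply/funext => z; rewrite row_mxEr.
Qed.

Lemma param_measurable_cons d (Y : measurableType d) k
    (f : Y -> 'rV[R]_k.+1 -> \bar R) :
  param_measurable f ->
  param_measurable (fun (p : (Y * Rm)%type) v =>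
    f p.1 (row_mx (\row_(j < 1) p.2) v)).
Proof.
move=> mf d1 Z y u my mu.
apply: mf; first exact: measurableT_comp measurable_fst my.
by apply: row_cons_measurable => //; exact: measurableT_comp measurable_snd my.
Qed.

Lemma iter_int_ge0 k (f : 'rV[R]_k -> \bar R) :
  (forall v, 0 <= f v)%E -> (0 <= iter_int f)%E.
Proof.
elim: k f => [|k IH] f f0 /=; first exact: f0.
by apply: integral_ge0 => x _; apply: IH => v.
Qed.

(** The parameter space must be arbitrary: slicing off the first coordinate replaces [Y] by
    [Y * Rm], and Tonelli handles the integral over that coordinate. *)
Lemma iter_int_measurable k d (Y : measurableType d)
    (f : Y -> 'rV[R]_k -> \bar R) :
  param_measurable f -> (forall y v, 0 <= f y v)%E ->
  measurable_fun setT (fun y => iter_int (f y)).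
Proof.
elim: k d Y f => [|k IH] d Y f mf f0 /=.
  apply: (mf _ Y id (fun=> 0)) => [|i]; first exact: measurable_id.
  by under eq_fun do rewrite mxE; exact: measurable_cst.
pose g := fun (p : (Y * Rm)%type) v => f p.1 (row_mx (\row_(j < 1) p.2) v).
have mg : measurable_fun setT (fun p : (Y * Rm)%type => iter_int (g p)).
  by apply: IH => [|p v]; [exact: param_measurable_cons|exact: f0].
apply: (measurable_fun_fubini_tonelli_F (m2 := lambda) (fun p => iter_int (g p))) => //.
by move=> p; apply: iter_int_ge0 => v; exact: f0.
Qed.

Lemma iter_int_slice_measurable k (f : 'rV[R]_k.+1 -> \bar R) :
  param_measurable (fun _ : unit => f) -> (forall v, 0 <= f v)%E ->
  measurable_fun setT
    (fun x : Rm => iter_int (fun v => f (row_mx (\row_(j < 1) x) v))).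
Proof.
move=> mf f0; apply: iter_int_measurable => // d1 Z y u my mu.
apply: (mf _ Z (fun=> tt)); first exact: measurable_cst.
exact: row_cons_measurable.
Qed.

Lemma slice_measurable k (f : 'rV[R]_k.+1 -> \bar R) (x : R) :
  param_measurable (fun _ : unit => f) ->
  param_measurable (fun _ : unit => fun v => f (row_mx (\row_(j < 1) x) v)).
Proof.
move=> mf d1 Z y u my mu; apply: (mf _ Z (fun=> tt)) => //.
by apply: row_cons_measurable => //; exact: measurable_cst.
Qed.

(** Tonelli moves the integral over [t] past one coordinate at a time. *)
Lemma iter_int_swap k (f : Rm -> 'rV[R]_k -> \bar R) :
  param_measurable f -> (forall t v, 0 <= f t v)%E ->
  (\int[lambda]_t iter_int (f t) = iter_int (fun v => \int[lambda]_t f t v))%E.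
Proof.
elim: k f => [//|k IH] f mf f0 /=.
pose g := fun (p : (Rm * Rm)%type) v => f p.1 (row_mx (\row_(j < 1) p.2) v).
rewrite (fubini_tonelli (m1 := lambda) (m2 := lambda) (fun p => iter_int (g p))); last 2 first.
- apply: iter_int_measurable => [|p v]; last exact: f0.
  exact: param_measurable_cons.
- by move=> p; apply: iter_int_ge0 => v; exact: f0.
apply: eq_integral => x _; rewrite /g/= IH// => d1 Z y u my mu.
by apply: mf => //; apply: row_cons_measurable => //; exact: measurable_cst.
Qed.

Lemma eq_iter_int k (f g : 'rV[R]_k -> \bar R) :
  f =1 g -> iter_int f = iter_int g.
Proof. by move=> /funext ->. Qed.

Lemma iter_intD k (f g : 'rV[R]_k -> \bar R) :
  param_measurable (fun _ : unit => f) -> (forall v, 0 <= f v)%E ->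
  param_measurable (fun _ : unit => g) -> (forall v, 0 <= g v)%E ->
  (iter_int (fun v => f v + g v) = iter_int f + iter_int g)%E.
Proof.
elim: k f g => [//|k IH] f g mf f0 mg g0 /=.
rewrite -ge0_integralD//.
- by apply: eq_integral => x _; rewrite IH//; exact: slice_measurable.
- by move=> x _; exact: iter_int_ge0.
- exact: iter_int_slice_measurable.
- by move=> x _; exact: iter_int_ge0.
- exact: iter_int_slice_measurable.
Qed.

Lemma iter_intZ k (c : R) (f : 'rV[R]_k -> \bar R) : 0 <= c ->
  param_measurable (fun _ : unit => f) -> (forall v, 0 <= f v)%E ->
  (iter_int (fun v => c%:E * f v) = c%:E * iter_int f)%E.
Proof.
elim: k f => [//|k IH] f c0 mf f0 /=.
rewrite -ge0_integralZl//.
- by apply: eq_integral => x _; rewrite IH//; exact: slice_measurable.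
- exact: iter_int_slice_measurable.
- by move=> x _; exact: iter_int_ge0.
Qed.

Lemma le_iter_int k (f g : 'rV[R]_k -> \bar R) :
  param_measurable (fun _ : unit => f) -> (forall v, 0 <= f v)%E ->
  param_measurable (fun _ : unit => g) -> (forall v, f v <= g v)%E ->
  (iter_int f <= iter_int g)%E.
Proof.
elim: k f g => [//|k IH] f g mf f0 mg fg /=; first exact: fg.
have g0 v : (0 <= g v)%E by apply: le_trans (fg v).
apply: ge0_le_integral => //.
- by move=> x _; exact: iter_int_ge0.
- exact: iter_int_slice_measurable.
- exact: iter_int_slice_measurable.
- by move=> x _; apply: IH => //; exact: slice_measurable.
Qed.

(** Every coordinate contributes [t^-1] by [integral_affine]. The case [p = 0] serves the
    substitution [y = t x], the case [t = 1] moves the apex of a cone to the origin. *)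
Lemma iter_int_affine k (t : R) (p : 'rV[R]_k) (f : 'rV[R]_k -> \bar R) : 0 < t ->
  param_measurable (fun _ : unit => f) -> (forall v, 0 <= f v)%E ->
  (iter_int (fun v => f (t *: v + p)%R) = ((t ^- k)%R)%:E * iter_int f)%E.
Proof.
move=> t0; elim: k p f => [|k IH] p f mf f0 /=.
  by rewrite expr0 invr1 mul1e; congr f; apply/rowP => -[].
pose a : R := p ord0 (@lshift 1 k ord0); pose q : 'rV[R]_k := \row_i p ord0 (rshift 1 i).
have split_affine (x : R) v : t *: row_mx (\row_(j < 1) x) v + p =
    row_mx (\row_(j < 1) (t * x + a)) (t *: v + q).
  apply/rowP => i; rewrite !mxE; case: splitP => j ij; rewrite !mxE.
    by rewrite (_ : i = @lshift 1 k ord0)//; apply/val_inj; rewrite /= ij ord1.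
  by rewrite (_ : i = rshift 1 j)//; apply/val_inj; rewrite /= ij.
under eq_integral => x _.
  under eq_iter_int => v do rewrite split_affine.
  rewrite (IH q (fun v => f (row_mx (\row_(j < 1) (t * x + a)) v)))//; last exact: slice_measurable.
  over.
rewrite ge0_integralZl//=; first last.
- by rewrite lee_fin invr_ge0 exprn_ge0// ltW.
- by move=> x _; exact: iter_int_ge0.
- apply: (measurableT_comp (f := fun y : Rm => iter_int (fun v => f (row_mx (\row_(j < 1) y) v)))).
    exact: iter_int_slice_measurable.
  by apply: measurable_funD => //; exact: measurable_funM.
rewrite (@integral_affine t a (fun y => iter_int (fun v => f (row_mx (\row_(j < 1) y) v))))//.
- by rewrite muleA -EFinM exprS invfM mulrC.
- exact: iter_int_slice_measurable.
- by move=> x; exact: iter_int_ge0.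
Qed.

(** The origin lies on the null hyperplane where the first coordinate vanishes. Positive dimension
    matters: in dimension 0 the integral is evaluation at the origin. *)
Lemma eq_iter_int_neq0 k (f g : 'rV[R]_k.+1 -> \bar R) :
  param_measurable (fun _ : unit => f) -> (forall v, 0 <= f v)%E ->
  param_measurable (fun _ : unit => g) -> (forall v, 0 <= g v)%E ->
  (forall v, v != 0 -> f v = g v) -> iter_int f = iter_int g.
Proof.
move=> mf f0 mg g0 fg /=.
apply: ge0_ae_eq_integral => //.
- exact: iter_int_slice_measurable.
- exact: iter_int_slice_measurable.
- by move=> x _; exact: iter_int_ge0.
- by move=> x _; exact: iter_int_ge0.
exists [set 0]; split => //; first exact: lebesgue_measure_set1.
move=> x /= xE; apply: contrapT => x0; apply: xE => _.
apply: eq_iter_int => v; apply: fg; apply: contra_notN x0.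
move=> /eqP e; have e' : row_mx (\row_(j < 1) x) v = 0 :> 'rV_(1 + k) := e.
by have := row_mxEl (\row_(j < 1) x) v ord0 (ord0 : 'I_1); rewrite e' !mxE => <-.
Qed.

Definition box (k : nat) (b : R) : set 'rV[R]_k :=
  [set v | forall i, `|v ord0 i| <= b].

(** A box is a product, so its iterated integral is computed directly; boxes serve as majorants for
    balls and the shell. *)
Lemma iter_int_box k (b : R) : 0 <= b ->
  iter_int (fun v : 'rV[R]_k => (\1_(@box k b) v)%:E) = ((2 * b) ^+ k)%:E.
Proof.
move=> b0; elim: k => [|k IH] /=.
  by rewrite indicE mem_set// => -[].
transitivity (\int[lambda]_x (((2 * b) ^+ k)%:E * (\1_(`[- b, b]%classic) x)%:E))%E.
  apply: eq_integral => x _; rewrite -IH.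
  case: (boolP (x \in `[- b, b]%classic)) => xb.
    have -> : \1_(`[- b, b]%classic) x = 1 :> R by rewrite indicE xb.
    rewrite mule1; apply: eq_iter_int => v.
    suff E : (row_mx (\row_(j < 1) x) v \in @box k.+1 b) = (v \in @box k b).
      by rewrite !indicE E.
    apply/idP/idP.
    - rewrite !inE /box/= => H i.
      by rewrite -(row_mxEr (\row_(j < 1) x) v ord0 i); exact: (H (rshift 1 i)).
    - rewrite !inE /box/= => H i; case: (@splitP 1 k i) => j ij.
      + have -> : (row_mx (\row_(j < 1) x) v : 'rV_k.+1) ord0 i = x.
          rewrite (_ : i = lshift k j); last exact/val_inj.
          by apply: etrans (row_mxEl _ _ _ _) _; rewrite mxE.
        by rewrite ler_norml; move: xb; rewrite inE/= in_itv.
      + have -> : (row_mx (\row_(j < 1) x) v : 'rV_k.+1) ord0 i = v ord0 j.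
          by rewrite (_ : i = rshift 1 j); [exact: row_mxEr|exact/val_inj].
        exact: H.
  have -> : \1_(`[- b, b]%classic) x = 0 :> R by rewrite indicE (negbTE xb).
  rewrite mule0.
  (* Zero is written as a product so that [iter_intZ] with factor 0 evaluates the integral. *)
  transitivity (iter_int (fun v : 'rV[R]_k => (0 * 0)%:E : \bar R)).
    apply: eq_iter_int => v; congr (_%:E); rewrite indicE mul0r.
    rewrite memNset// => /(_ (@lshift 1 k ord0)).
    have -> : (row_mx (\row_(j < 1) x) v : 'rV_k.+1) ord0 (@lshift 1 k ord0) = x.
      by apply: etrans (row_mxEl _ _ _ _) _; rewrite mxE.
    rewrite ler_norml => H; by move: xb; rewrite notin_setE/= in_itv/= H.
  by rewrite (iter_intZ (c := 0) (f := fun=> 0%:E))// mul0e.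
have mE : measurable_fun setT (fun x : Rm => (\1_(`[- b, b]%classic) x : R)%:E).
  exact/measurable_EFinP/measurable_indic.
have c0 : (0 <= ((2 * b) ^+ k)%:E)%E by rewrite lee_fin exprn_ge0// mulr_ge0.
have i0 (x : R) : setT x -> (0 <= (\1_(`[- b, b]%classic) x : R)%:E)%E by rewrite lee_fin.
rewrite ge0_integralZl//.
rewrite integral_indic//= setIT lebesgue_measure_itv/= lte_fin.
rewrite exprSr.
case: ifPn => bb; first by rewrite -EFinD -EFinM; congr EFin; congr (_ * _); ring.
have -> : b = 0 by move: bb b0; rewrite -leNgt; lra.
by rewrite !mulr0 mule0.
Qed.

End IteratedIntegral.

(** * Integrals of bounded signed functions supported in a box *)

Section SignedIntegral.
Context {R : realType} (k : nat) (b : R).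
Hypothesis b0 : 0 <= b.
Local Notation Rm := (measurableTypeR R).
Implicit Types (f g h : 'rV[R]_k -> R) (M : R).

Definition rv_measurable f := param_measurable (fun _ : unit => f : _ -> Rm).

Definition box_bounded M f := forall v, `|f v| <= M * \1_(@box R k b) v.

Lemma rv_measurable_EFin f : rv_measurable f ->
  param_measurable (fun _ : unit => fun v => (f v)%:E).
Proof.
by move=> mf d Z y u my mu; apply/measurable_EFinP; exact: (mf _ _ y).
Qed.

Lemma box_measurable : rv_measurable (\1_(@box R k b)).
Proof.
move=> d Z y u my mu; rewrite -[X in measurable_fun _ X]/(\1_[set z | box b (u z)]).
apply: measurable_indic.
rewrite (_ : [set z | _] = \big[setI/setT]_(i < k) [set z | `|u z ord0 i| <= b]).
  apply: bigsetI_measurable => i _.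
  have -> : [set z | `|u z ord0 i| <= b] = (fun z => `|u z ord0 i|) @^-1` `]-oo, b].
    by apply/seteqP; split => z; rewrite /= in_itv.
  rewrite -[X in measurable X]setTI.
  have mn : measurable_fun setT (fun z => `|u z ord0 i| : Rm) by apply: measurableT_comp => //; exact: mu.
  exact: mn.
apply/seteqP; split => z.
  by move=> H; rewrite -bigcap_seq => i _; exact: H.
by rewrite -bigcap_seq => H i; apply: H; rewrite /= mem_index_enum.
Qed.

Lemma box_bounded_iter_int M f : rv_measurable f -> box_bounded M f ->
  (forall v, 0 <= f v) ->
  iter_int (fun v => (f v)%:E) \is a fin_num /\
  fine (iter_int (fun v => (f v)%:E)) <= M * (2 * b) ^+ k.
Proof.
move=> mf bf f0.
have i0 : (0 <= iter_int (fun v => (f v)%:E))%E.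
  by apply: iter_int_ge0 => v; rewrite lee_fin.
have ile : (iter_int (fun v => (f v)%:E) <= (M * (2 * b) ^+ k)%:E)%E.
  have [M0|M0] := leP 0 M.
    have bm := rv_measurable_EFin box_measurable.
    have bn v : (0 <= (\1_(@box R k b) v : R)%:E)%E by rewrite lee_fin.
    rewrite EFinM -iter_int_box// -iter_intZ//.
    apply: le_iter_int.
    - exact: rv_measurable_EFin.
    - by move=> v; rewrite lee_fin.
    - apply: rv_measurable_EFin => d Z y u my mu; apply: measurable_funM => //.
      exact: (box_measurable my).
    - by move=> v; rewrite lee_fin; apply: le_trans (bf v); exact: ler_norm.
  (* A negative [M] is contradictory, because the box contains the origin. *)
  have := bf 0; rewrite indicE mem_set ?mulr1; last by move=> i; rewrite mxE normr0.
  by rewrite leNgt (lt_le_trans M0).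
have fn : iter_int (fun v => (f v)%:E) \is a fin_num.
  by rewrite ge0_fin_numE// (le_lt_trans ile)// ltry.
by split => //; rewrite -lee_fin fineK.
Qed.

(** [iter_int] is handled only on nonnegative functions, but powers of [ray_slope] change sign.
    Under [box_bounded] both parts are finite, so [fine] loses nothing. *)
Definition signed_int f : R :=
  fine (iter_int (fun v => (Num.max (f v) 0)%:E)) -
  fine (iter_int (fun v => (Num.max (- f v) 0)%:E)).

Lemma fine_iter_intD M M' f g :
  rv_measurable f -> box_bounded M f -> (forall v, 0 <= f v) ->
  rv_measurable g -> box_bounded M' g -> (forall v, 0 <= g v) ->
  fine (iter_int (fun v => (f v + g v)%:E)) =
  fine (iter_int (fun v => (f v)%:E)) + fine (iter_int (fun v => (g v)%:E)).
Proof.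
move=> mf bf f0 mg bg g0.
have [ff _] := box_bounded_iter_int mf bf f0.
have [fg _] := box_bounded_iter_int mg bg g0.
rewrite -fineD// -iter_intD//.
- exact: rv_measurable_EFin.
- exact: rv_measurable_EFin.
Qed.

Lemma rv_measurable_pos f : rv_measurable f ->
  rv_measurable (fun v => Num.max (f v) 0).
Proof.
by move=> mf d Z y u my mu; apply: measurable_maxr => //; exact: (mf _ _ y).
Qed.

Lemma rv_measurableN f : rv_measurable f -> rv_measurable (fun v => - f v).
Proof.
move=> mf d Z y u my mu; apply: measurableT_comp => //; exact: (mf _ _ y).
Qed.

Lemma rv_measurableM f g : rv_measurable f -> rv_measurable g ->
  rv_measurable (fun v => f v * g v).
Proof.
by move=> mf mg d Z y u my mu; apply: measurable_funM;
  [exact: (mf _ _ y)|exact: (mg _ _ y)].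
Qed.

Lemma rv_measurableD f g : rv_measurable f -> rv_measurable g ->
  rv_measurable (fun v => f v + g v).
Proof.
by move=> mf mg d Z y u my mu; apply: measurable_funD;
  [exact: (mf _ _ y)|exact: (mg _ _ y)].
Qed.

Lemma rv_measurable_cst (c : R) : rv_measurable (fun=> c).
Proof. by move=> d Z y u my mu; exact: measurable_cst. Qed.

Lemma box_bounded_pos M f : box_bounded M f ->
  box_bounded M (fun v => Num.max (f v) 0).
Proof.
move=> bf v; apply: le_trans (bf v).
by case: (leP (f v) 0) => h; rewrite ?normr0.
Qed.

Lemma box_boundedN M f : box_bounded M f -> box_bounded M (fun v => - f v).
Proof. by move=> bf v; rewrite normrN. Qed.

Lemma box_boundedD M M' f g : box_bounded M f -> box_bounded M' g ->
  box_bounded (M + M') (fun v => f v + g v).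
Proof.
by move=> bf bg v; rewrite mulrDl; apply: le_trans (ler_normD _ _) (lerD _ _).
Qed.

Lemma box_boundedZ M (c : R) f : box_bounded M f ->
  box_bounded (`|c| * M) (fun v => c * f v).
Proof. by move=> bf v; rewrite normrM -mulrA ler_wpM2l. Qed.

(** Independence of the decomposition: the positive part plus [h] equals [g] plus the negative part,
    and both sides are sums of nonnegative functions. *)
Lemma signed_int_sub M M' f g h :
  rv_measurable g -> box_bounded M g -> (forall v, 0 <= g v) ->
  rv_measurable h -> box_bounded M' h -> (forall v, 0 <= h v) ->
  (forall v, f v = g v - h v) ->
  signed_int f =
  fine (iter_int (fun v => (g v)%:E)) - fine (iter_int (fun v => (h v)%:E)).
Proof.
move=> mg bg g0 mh bh h0 /funext ->; rewrite /signed_int.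
set F := fun v => _.
have mgh : rv_measurable (fun v => g v - h v).
  exact: rv_measurableD mg (rv_measurableN mh).
have bgh := box_boundedD bg (box_boundedN bh).
apply/eqP; rewrite subr_eq addrAC -subr_eq opprK; apply/eqP.
rewrite -(fine_iter_intD (rv_measurable_pos mgh) (box_bounded_pos bgh) _ mh bh h0);
  last by move=> v; rewrite le_max lexx orbT.
rewrite -(fine_iter_intD mg bg g0 (rv_measurable_pos (rv_measurableN mgh))
  (box_bounded_pos (box_boundedN bgh))); last by move=> v; rewrite le_max lexx orbT.
congr fine; apply: eq_iter_int => v; congr EFin.
by rewrite /Num.max; case: ifPn; case: ifPn; rewrite -?leNgt; lra.
Qed.

Lemma signed_int_ge0 M f : rv_measurable f -> box_bounded M f ->
  (forall v, 0 <= f v) -> signed_int f = fine (iter_int (fun v => (f v)%:E)).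
Proof.
move=> mf bf f0.
have b0' : box_bounded 0 (fun=> 0) by move=> v; rewrite normr0 mul0r.
have fE v : f v = f v - (fun=> 0) v by rewrite subr0.
rewrite (signed_int_sub mf bf f0 (rv_measurable_cst 0) b0' _ fE)//.
have [_] := box_bounded_iter_int (rv_measurable_cst 0) b0' (fun=> lexx 0).
rewrite mul0r => h.
have h' : 0 <= fine (iter_int (fun _ : 'rV[R]_k => 0%:E)).
  by apply: fine_ge0; apply: iter_int_ge0.
have -> : fine (iter_int (fun _ : 'rV[R]_k => 0%:E)) = 0 by apply: le_anti; rewrite h h'.
by rewrite subr0.
Qed.

(** Both parts lie between 0 and the bound, so their difference costs no factor 2. *)
Lemma signed_int_le M f : rv_measurable f -> box_bounded M f ->
  `|signed_int f| <= M * (2 * b) ^+ k.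
Proof.
move=> mf bf.
have p0 g v : 0 <= Num.max (g v) 0 by rewrite le_max lexx orbT.
have [_ h1] := box_bounded_iter_int (rv_measurable_pos mf) (box_bounded_pos bf) (p0 f).
have [_ h2] := box_bounded_iter_int (rv_measurable_pos (rv_measurableN mf))
  (box_bounded_pos (box_boundedN bf)) (p0 (fun v => - f v)).
have h3 g : 0 <= fine (iter_int (fun v => (Num.max (g v) 0)%:E)).
  by apply: fine_ge0; apply: iter_int_ge0 => v; rewrite lee_fin.
rewrite /signed_int ler_norml; move: h1 h2 (h3 f) (h3 (fun v => - f v)).
set x := fine _; set y := fine _; set z := M * _; lra.
Qed.

Lemma fine_iter_intZ M (c : R) f : 0 <= c ->
  rv_measurable f -> box_bounded M f -> (forall v, 0 <= f v) ->
  fine (iter_int (fun v => (c * f v)%:E)) = c * fine (iter_int (fun v => (f v)%:E)).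
Proof.
move=> c0 mf bf f0.
have [ff _] := box_bounded_iter_int mf bf f0.
rewrite -[c in RHS]/(fine c%:E) -fineM// -iter_intZ//.
exact: rv_measurable_EFin.
Qed.

Lemma signed_int_lin M M' (c : R) f g :
  rv_measurable f -> box_bounded M f -> rv_measurable g -> box_bounded M' g ->
  signed_int (fun v => f v + c * g v) = signed_int f + c * signed_int g.
Proof.
move=> mf bf mg bg.
have p0 h v : 0 <= Num.max (h v) 0 by rewrite le_max lexx orbT.
have mZ (a : R) h : rv_measurable h -> rv_measurable (fun v => a * h v).
  by move=> mh; apply: rv_measurableM => //; exact: rv_measurable_cst.
have maxE (x : R) : x = Num.max x 0 - Num.max (- x) 0.
  by rewrite /Num.max; case: ifPn; case: ifPn; rewrite -?leNgt; lra.
have mNf := rv_measurableN mf; have mNg := rv_measurableN mg.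
have bNf := box_boundedN bf; have bNg := box_boundedN bg.
have [c0|c0] := leP 0 c.
  rewrite (@signed_int_sub _ _ _
    (fun v => Num.max (f v) 0 + c * Num.max (g v) 0)
    (fun v => Num.max (- f v) 0 + c * Num.max (- g v) 0)
    (rv_measurableD (rv_measurable_pos mf) (mZ c _ (rv_measurable_pos mg)))
    (box_boundedD (box_bounded_pos bf) (box_boundedZ c (box_bounded_pos bg))) _
    (rv_measurableD (rv_measurable_pos mNf) (mZ c _ (rv_measurable_pos mNg)))
    (box_boundedD (box_bounded_pos bNf) (box_boundedZ c (box_bounded_pos bNg)))).
  - rewrite (fine_iter_intD (rv_measurable_pos mf) (box_bounded_pos bf) (p0 _)
      (mZ c _ (rv_measurable_pos mg)) (box_boundedZ c (box_bounded_pos bg))); last first.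
      by move=> v; rewrite mulr_ge0.
    rewrite (fine_iter_intD (rv_measurable_pos mNf) (box_bounded_pos bNf) (p0 (fun v => - f v))
      (mZ c _ (rv_measurable_pos mNg)) (box_boundedZ c (box_bounded_pos bNg))); last first.
      by move=> v; rewrite mulr_ge0// (p0 (fun v => - g v)).
    rewrite (fine_iter_intZ c0 (rv_measurable_pos mg) (box_bounded_pos bg) (p0 _)).
    rewrite (fine_iter_intZ c0 (rv_measurable_pos mNg) (box_bounded_pos bNg) (p0 (fun v => - g v))).
    by rewrite /signed_int; ring.
  - by move=> v; rewrite addr_ge0 ?mulr_ge0.
  - by move=> v; rewrite addr_ge0 ?mulr_ge0 ?(p0 (fun v => - g v)) ?(p0 (fun v => - f v)).
  - by move=> v; rewrite {1}(maxE (f v)) {1}(maxE (g v)); ring.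
(* For negative [c] the two parts of [g] trade places, which keeps all coefficients nonnegative. *)
have d0 : 0 <= - c by rewrite oppr_ge0 ltW.
rewrite (@signed_int_sub _ _ _
  (fun v => Num.max (f v) 0 + (- c) * Num.max (- g v) 0)
  (fun v => Num.max (- f v) 0 + (- c) * Num.max (g v) 0)
  (rv_measurableD (rv_measurable_pos mf) (mZ (- c) _ (rv_measurable_pos mNg)))
  (box_boundedD (box_bounded_pos bf) (box_boundedZ (- c) (box_bounded_pos bNg))) _
  (rv_measurableD (rv_measurable_pos mNf) (mZ (- c) _ (rv_measurable_pos mg)))
  (box_boundedD (box_bounded_pos bNf) (box_boundedZ (- c) (box_bounded_pos bg)))).
- rewrite (fine_iter_intD (rv_measurable_pos mf) (box_bounded_pos bf) (p0 _)
    (mZ (- c) _ (rv_measurable_pos mNg)) (box_boundedZ (- c) (box_bounded_pos bNg))); last first.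
    by move=> v; rewrite mulr_ge0// (p0 (fun v => - g v)).
  rewrite (fine_iter_intD (rv_measurable_pos mNf) (box_bounded_pos bNf) (p0 (fun v => - f v))
    (mZ (- c) _ (rv_measurable_pos mg)) (box_boundedZ (- c) (box_bounded_pos bg))); last first.
    by move=> v; rewrite mulr_ge0.
  rewrite (fine_iter_intZ d0 (rv_measurable_pos mg) (box_bounded_pos bg) (p0 _)).
  rewrite (fine_iter_intZ d0 (rv_measurable_pos mNg) (box_bounded_pos bNg) (p0 (fun v => - g v))).
  by rewrite /signed_int; ring.
- by move=> v; rewrite addr_ge0 ?mulr_ge0 ?(p0 (fun v => - g v)).
- by move=> v; rewrite addr_ge0 ?mulr_ge0 ?(p0 (fun v => - f v)).
- by move=> v; rewrite {1}(maxE (f v)) {1}(maxE (g v)); ring.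
Qed.

End SignedIntegral.

(** * Volume of a cone inside a ball *)

Section DotProduct.
Context {R : realType} {n : nat}.
Implicit Types (a u v w : 'rV[R]_n) (t : R).

Definition dot u v : R := \sum_(i < n) u ord0 i * v ord0 i.
Definition nrm u : R := Num.sqrt (dot u u).

Lemma dotC u v : dot u v = dot v u.
Proof. by apply: eq_bigr => i _; rewrite mulrC. Qed.

Lemma dotDl u v w : dot (u + v) w = dot u w + dot v w.
Proof. by rewrite -big_split; apply: eq_bigr => i _; rewrite mxE mulrDl. Qed.

Lemma dotZl t u v : dot (t *: u) v = t * dot u v.
Proof. by rewrite /dot mulr_sumr; apply: eq_bigr => i _; rewrite mxE mulrA. Qed.

Lemma dotDr u v w : dot w (u + v) = dot w u + dot w v.
Proof. by rewrite dotC dotDl !(dotC w). Qed.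

Lemma dotZr t u v : dot u (t *: v) = t * dot u v.
Proof. by rewrite dotC dotZl dotC. Qed.

Lemma dot_ge0 u : 0 <= dot u u.
Proof. by apply: sumr_ge0 => i _; rewrite -expr2 sqr_ge0. Qed.

Lemma nrm_ge0 u : 0 <= nrm u.
Proof. exact: sqrtr_ge0. Qed.

Lemma sqr_nrm u : nrm u ^+ 2 = dot u u.
Proof. by rewrite sqr_sqrtr// dot_ge0. Qed.

Lemma nrm0 : nrm 0 = 0.
Proof.
by rewrite /nrm (_ : dot 0 0 = 0) ?sqrtr0//; apply: big1 => i _; rewrite mxE mul0r.
Qed.

Lemma ler_coord_nrm u i : `|u ord0 i| <= nrm u.
Proof.
rewrite -sqrtr_sqr ler_wsqrtr// /dot (bigD1 i)//= -expr2 lerDl.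
by apply: sumr_ge0 => j _; rewrite -expr2 sqr_ge0.
Qed.

Lemma nrm_gt0 u : u != 0 -> 0 < nrm u.
Proof.
apply: contra_neqT; rewrite -leNgt => h; apply/rowP => i; rewrite mxE.
by apply/eqP; rewrite -normr_le0; exact: le_trans (ler_coord_nrm u i) h.
Qed.

Lemma nrmZ t u : 0 <= t -> nrm (t *: u) = t * nrm u.
Proof.
move=> t0; rewrite /nrm dotZl dotZr mulrA -expr2 sqrtrM ?sqr_ge0//.
by rewrite sqrtr_sqr ger0_norm.
Qed.

Lemma CauchySchwarz_dot u v : dot u v ^+ 2 <= dot u u * dot v v.
Proof.
have [->|v0] := eqVneq v 0.
  rewrite (_ : dot u 0 = 0) ?expr0n/= ?mulr_ge0 ?dot_ge0//.
  by apply: big1 => i _; rewrite mxE mulr0.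
have V0 : 0 < dot v v by rewrite -sqr_nrm exprn_gt0// nrm_gt0.
(* The squared length of this vector is [dot v v] times the gap in the inequality. *)
have := dot_ge0 (dot v v *: u + (- dot u v) *: v).
rewrite !(dotDl, dotDr, dotZl, dotZr) (dotC v u) => h.
rewrite -subr_ge0 -(pmulr_rge0 _ V0); apply: le_trans h _.
by rewrite le_eqVlt; apply/orP; left; apply/eqP; ring.
Qed.

End DotProduct.

Section DotMeasurable.
Context {R : realType} {n : nat} d (Z : measurableType d).
Local Notation Rm := (measurableTypeR R).
Implicit Types (u w : Z -> 'rV[R]_n).

Lemma coord_measurable_cst (p : 'rV[R]_n) : coord_measurable (fun _ : Z => p).
Proof. by move=> i; exact: measurable_cst. Qed.

Lemma coord_measurableD u w : coord_measurable u -> coord_measurable w ->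
  coord_measurable (fun z => u z + w z).
Proof.
move=> mu mw i; rewrite (_ : (fun z => _) = fun z => u z ord0 i + w z ord0 i).
  by apply: measurable_funD; [exact: mu|exact: mw].
by apply/funext => z; rewrite mxE.
Qed.

Lemma coord_measurableZ (y : Z -> Rm) u : measurable_fun setT y ->
  coord_measurable u -> coord_measurable (fun z => (y z : R) *: u z).
Proof.
move=> my mu i; rewrite (_ : (fun z => _) = fun z => (y z : R) * u z ord0 i).
  by apply: measurable_funM => //; exact: mu.
by apply/funext => z; rewrite mxE.
Qed.

Lemma dot_measurable u w : coord_measurable u -> coord_measurable w ->
  measurable_fun setT (fun z => dot (u z) (w z) : Rm).
Proof.
by move=> mu mw; apply: measurable_sum => i; apply: measurable_funM; [exact: mu|exact: mw].
Qed.

Lemma nrm_measurable u : coord_measurable u ->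
  measurable_fun setT (fun z => nrm (u z) : Rm).
Proof.
move=> mu; apply: (measurableT_comp (f := @Num.sqrt R)).
  by apply: continuous_measurable_fun; exact: sqrt_continuous.
exact: dot_measurable.
Qed.

Lemma nrmV_measurable u : coord_measurable u ->
  measurable_fun setT (fun z => (nrm (u z))^-1 : Rm).
Proof.
move=> mu; rewrite (_ : (fun z => _) = fun z => nrm (u z) `^ (-1)).
  by apply: (measurableT_comp (measurable_powR _)); exact: nrm_measurable.
by apply/funext => z; rewrite powR_inv1// nrm_ge0.
Qed.

Lemma ifb_measurable (b : Z -> bool) (f : Z -> Rm) :
  measurable_fun setT b -> measurable_fun setT f ->
  measurable_fun setT (fun z => if b z then f z else 0 : Rm).
Proof. by move=> mb mf; exact: measurable_fun_ifT. Qed.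

End DotMeasurable.

Lemma integral_monomial (R : realType) (m : nat) (c rho : R) : 0 < rho ->
  (\int[@lebesgue_measure R]_(t in `]0%R, rho]) (c * (m.+1%:R * t ^+ m))%:E =
   (c * rho ^+ m.+1)%:E)%E.
Proof.
move=> rho0.
have cf : continuous (fun t : R => c * (m.+1%:R * t ^+ m)).
  move=> x; apply: cvgM; first exact: cvg_cst.
  by apply: cvgM; [exact: cvg_cst|exact: exprn_continuous].
rewrite integral_itv_obnd_cbnd; last first.
  apply/measurable_EFinP; apply: measurable_funTS.
  exact: continuous_measurable_fun.
have cF : continuous (fun t : R => c * t ^+ m.+1).
  by move=> x; apply: cvgM; [exact: cvg_cst|exact: exprn_continuous].
rewrite (@continuous_FTC2 _ _ (fun t => c * t ^+ m.+1) 0 rho)//.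
- by rewrite expr0n mulr0 sube0.
- exact: continuous_subspaceT.
- split.
  + by move=> x _; apply: derivableM => //; exact: exprn_derivable.
  + exact/cvg_at_right_filter/cF.
  + exact/cvg_at_left_filter/cF.
- move=> x _; rewrite derive1Ml; last exact: exprn_derivable.
  by rewrite exp_derive1.
Qed.

(** * Integration along the rays of a cone *)

Section ConeVolume.
Context {R : realType} (m : nat).
Local Notation n := m.+1.
Local Notation Rm := (measurableTypeR R).
Local Notation lambda := (@lebesgue_measure R).
Variables (C : set 'rV[R]_n) (q : 'rV[R]_n).
Hypothesis mC : rv_measurable (\1_C).
Hypothesis coneC : forall (t : R) x, 0 < t -> C (t *: x) <-> C x.

Implicit Types (x y : 'rV[R]_n) (r t : R).

Definition shell : set 'rV[R]_n := [set x | 1 <= nrm x <= 2].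

Definition cone_ball r : set 'rV[R]_n :=
  [set y | C y /\ dot (y + q) (y + q) <= r ^+ 2].

(** With the apex at the origin the ball is centred at [- q]; this is the position along the ray of
    the foot of the perpendicular from the centre, and [ray_dist2] is the squared distance from the
    centre to the line. *)
Definition ray_slope x : R := - dot q x / nrm x.
Definition ray_dist2 x : R := dot q q - ray_slope x ^+ 2.
Definition ray_length r x : R :=
  (ray_slope x + Num.sqrt (r ^+ 2 - ray_dist2 x)) / nrm x.

Lemma sqr_ray_slope_le x : ray_slope x ^+ 2 <= dot q q.
Proof.
have [->|x0] := eqVneq x 0.
  by rewrite /ray_slope nrm0 invr0 mulr0 expr0n/= dot_ge0.
have X0 := nrm_gt0 x0.
rewrite /ray_slope expr_div_n sqrrN ler_pdivrMr ?exprn_gt0// sqr_nrm.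
exact: CauchySchwarz_dot.
Qed.

Lemma ray_dist2_ge0 x : 0 <= ray_dist2 x.
Proof. by rewrite /ray_dist2 subr_ge0 sqr_ray_slope_le. Qed.

Lemma ray_dist2_le x : ray_dist2 x <= dot q q.
Proof. by rewrite /ray_dist2 lerBlDr lerDl sqr_ge0. Qed.

Lemma ray_discr r x : dot q q < r ^+ 2 ->
  ray_slope x ^+ 2 < r ^+ 2 - ray_dist2 x.
Proof. by rewrite /ray_dist2 => h; lra. Qed.

Lemma ray_length_gt0 r x : dot q q < r ^+ 2 -> x != 0 -> 0 < ray_length r x.
Proof.
move=> hr x0; rewrite /ray_length divr_gt0 ?nrm_gt0//.
have h := ray_discr x hr.
set s := Num.sqrt _; have s0 : 0 <= s by exact: sqrtr_ge0.
have : s ^+ 2 = r ^+ 2 - ray_dist2 x.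
  by rewrite sqr_sqrtr// ltW// (le_lt_trans _ h)// sqr_ge0.
by move: h s0; clearbody s; move: (ray_slope x) => a h s0 e; nra.
Qed.

(** Completing the square in [tau = t |x|] gives [(tau - a)^2 <= s^2], with [a] the slope. The apex
    is strictly inside the ball, so [|a| < s], the smaller root is negative, and only the larger one
    constrains positive [tau]. *)
Lemma ray_lengthP r t x : dot q q < r ^+ 2 -> x != 0 -> 0 < t ->
  (dot (t *: x + q) (t *: x + q) <= r ^+ 2) = (t <= ray_length r x).
Proof.
move=> hr x0 t0; have X0 := nrm_gt0 x0.
have h := ray_discr x hr.
have e1 : dot q x = - ray_slope x * nrm x.
  by rewrite /ray_slope; field; rewrite gt_eqF.
rewrite /ray_length ler_pdivlMr//.
set s := Num.sqrt _; have s0 : 0 <= s by exact: sqrtr_ge0.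
have e2 : s ^+ 2 = r ^+ 2 - ray_dist2 x.
  by rewrite sqr_sqrtr// ltW// (le_lt_trans _ h)// sqr_ge0.
rewrite !(dotDl, dotDr, dotZl, dotZr) (dotC x q) e1 -(sqr_nrm x).
move: h e2; rewrite {}/ray_dist2; clearbody s.
have : 0 < t * nrm x by rewrite mulr_gt0.
move: (ray_slope x) (nrm x) (dot q q) => a N Q.
rewrite [X in (X <= _) = _](_ : _ = (t * N) ^+ 2 - 2 * a * (t * N) + Q); last by ring.
move: (t * N) => tau tau0 h e2; apply/idP/idP => H.
- by rewrite leNgt; apply/negP => H'; nra.
- have as_ : a <= s by nra.
  have h1 : 0 <= s - (tau - a) by lra.
  have h2 : 0 <= s + (tau - a) by lra.
  by have := mulr_ge0 h1 h2; nra.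
Qed.

Definition shell_weight x : R := \1_shell x / nrm x.

Lemma shell_measurable : rv_measurable (\1_shell).
Proof.
move=> d Z y u my mu.
rewrite (_ : (fun z => _) = fun z => if (1 <= nrm (u z)) && (nrm (u z) <= 2) then 1 else 0).
  apply: ifb_measurable; last exact: measurable_cst.
  have mn := nrm_measurable mu.
  apply: measurable_and; apply: measurable_fun_ler => //; exact: measurable_cst.
apply/funext => z; rewrite indicE; case: ifPn => h.
- by rewrite mem_set.
- by rewrite memNset//; exact/negP.
Qed.

Lemma shell_weight_measurable : rv_measurable shell_weight.
Proof.
move=> d Z y u my mu; apply: measurable_funM; first exact: (shell_measurable my).
exact: nrmV_measurable.
Qed.

Lemma shell_weight_ge0 x : 0 <= shell_weight x.
Proof. by rewrite divr_ge0// nrm_ge0. Qed.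

Lemma cone_ball_indicE r x :
  \1_(cone_ball r) x = \1_C x * (if dot (x + q) (x + q) <= r ^+ 2 then 1 else 0) :> R.
Proof.
rewrite !indicE; case: ifPn => h.
- rewrite mulr1; congr (_%:R); congr nat_of_bool; apply/idP/idP; rewrite !inE.
  + by case.
  + by split.
- by rewrite mulr0 memNset// => -[_]; rewrite (negbTE h).
Qed.

Lemma cone_ball_measurable r : rv_measurable (\1_(cone_ball r)).
Proof.
move=> d Z y u my mu.
rewrite (_ : (fun z => _) = fun z => \1_C (u z) *
   (if dot (u z + q) (u z + q) <= r ^+ 2 then 1 else 0)).
  apply: measurable_funM; first exact: (mC my).
  apply: ifb_measurable; last exact: measurable_cst.
  apply: measurable_fun_ler; last exact: measurable_cst.
  by apply: dot_measurable; apply: coord_measurableD => //; exact: coord_measurable_cst.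
by apply/funext => z; rewrite cone_ball_indicE.
Qed.

Lemma indic_cone t x : 0 < t -> \1_C (t *: x) = \1_C x :> R.
Proof.
move=> t0; rewrite !indicE; congr (_%:R); congr nat_of_bool.
by apply/idP/idP; rewrite !inE => /(coneC _ t0).
Qed.

Definition polar_integrand r t x : R :=
  if 0 < t then shell_weight x * (n%:R * t ^+ m) * \1_(cone_ball r) (t *: x) else 0.

(* [polar_integrand r t] in the variable [y = t x], with the Jacobian included. *)
Definition dilated_integrand r t y : R :=
  \1_(cone_ball r) y * (n%:R / nrm y) *
  (if (nrm y / 2 <= t) && (t <= nrm y) then 1 else 0).

Lemma polar_integrand_measurable r :
  param_measurable (fun (t : Rm) x => (polar_integrand r t x)%:E).
Proof.
move=> d Z y u my mu; apply/measurable_EFinP; apply: ifb_measurable.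
  by apply: measurable_fun_ltr => //; exact: measurable_cst.
have mtt : measurable_fun setT (fun _ : Z => tt) by exact: measurable_cst.
apply: measurable_funM; last first.
  exact: (cone_ball_measurable r mtt (coord_measurableZ my mu)).
apply: measurable_funM; first exact: (shell_weight_measurable mtt).
by apply: measurable_funM; [exact: measurable_cst|exact: measurable_funX].
Qed.

Lemma dilated_integrand_measurable r :
  param_measurable (fun (t : Rm) x => (dilated_integrand r t x)%:E).
Proof.
move=> d Z y u my mu; apply/measurable_EFinP.
have mtt : measurable_fun setT (fun _ : Z => tt) by exact: measurable_cst.
have mn := nrm_measurable mu.
apply: measurable_funM.
  apply: measurable_funM; first exact: (cone_ball_measurable r mtt).
  apply: measurable_funM; [exact: measurable_cst|exact: nrmV_measurable].
apply: ifb_measurable; last exact: measurable_cst.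
apply: measurable_and; apply: measurable_fun_ler => //.
by apply: measurable_funM => //; exact: measurable_cst.
Qed.

Lemma polar_integrand_ge0 r t x : 0 <= polar_integrand r t x.
Proof.
rewrite /polar_integrand; case: ifPn => // t0.
apply: mulr_ge0 => //; apply: mulr_ge0; first exact: shell_weight_ge0.
by apply: mulr_ge0 => //; apply: exprn_ge0; exact: ltW.
Qed.

Lemma dilated_integrand_ge0 r t x : 0 <= dilated_integrand r t x.
Proof.
by rewrite !mulr_ge0 ?invr_ge0 ?nrm_ge0//; case: ifP.
Qed.

Lemma integral_polar_integrand r x : dot q q < r ^+ 2 ->
  (\int[lambda]_t (polar_integrand r t x)%:E =
   (\1_C x * shell_weight x * ray_length r x ^+ n)%:E)%E.
Proof.
move=> hr.
have [xS|xS] := boolP (x \in shell); last first.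
  have w0 : shell_weight x = 0 by rewrite /shell_weight indicE (negbTE xS) mul0r.
  rewrite w0 mulr0 mul0r; apply: integral0_eq => t _.
  by rewrite /polar_integrand w0 !mul0r if_same.
have x0 : x != 0.
  by move: xS; rewrite inE /shell/=; apply: contraPneq => ->; rewrite nrm0 ler10.
have [xC|xC] := boolP (x \in C); last first.
  rewrite indicE (negbTE xC) !mul0r; apply: integral0_eq => t _.
  rewrite /polar_integrand; case: ifPn => // t0.
  by rewrite cone_ball_indicE indic_cone// indicE (negbTE xC) mul0r mulr0.
rewrite indicE xC mul1r -integral_monomial ?ray_length_gt0//.
rewrite [RHS]integral_mkcond; apply: eq_integral => t _.
rewrite patchE; case: ifPn; rewrite /polar_integrand.
- rewrite inE/= in_itv/= => /andP[t0 tr].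
  by rewrite t0 cone_ball_indicE indic_cone// indicE xC mul1r ray_lengthP// tr mulr1.
- rewrite notin_setE/= in_itv/= => /negP h; case: ifPn => // t0.
  by move: h; rewrite t0/= cone_ball_indicE ray_lengthP// => /negbTE ->; rewrite !mulr0.
Qed.

(** The factor [t ^+ n] cancels against the Jacobian of [iter_int_affine]. *)
Lemma polar_integrandE r t x : 0 < t ->
  polar_integrand r t x = t ^+ n * dilated_integrand r t (t *: x).
Proof.
move=> t0; rewrite /polar_integrand /dilated_integrand t0 nrmZ ?(ltW t0)//.
rewrite /shell_weight indicE.
have -> : (t * nrm x / 2 <= t) && (t <= t * nrm x) = (x \in shell).
  rewrite -mulrA ger_pMr// ler_pMr//.
  apply/idP/idP; rewrite inE /shell/= => /andP[h1 h2]; apply/andP; split; lra.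
case: ifPn => xS; rewrite ?xS ?(negbTE xS); last by rewrite !mul0r !mulr0.
have [->|x0] := eqVneq x 0; first by rewrite nrm0 !(mulr0, invr0, mul0r).
by rewrite exprS /= mulr1n; field; rewrite !gt_eqF ?nrm_gt0.
Qed.

(** The admissible [t] fill an interval of length [|y| / 2], which the weight [n / |y|] turns into
    the constant [n / 2]. *)
Lemma integral_dilated_integrand r y : y != 0 ->
  (\int[lambda]_t (dilated_integrand r t y)%:E =
   ((n%:R / 2) * \1_(cone_ball r) y)%:E)%E.
Proof.
move=> y0; have Y0 := nrm_gt0 y0.
pose c : R := \1_(cone_ball r) y * (n%:R / nrm y).
have c0 : 0 <= c by rewrite mulr_ge0// divr_ge0// ltW.
transitivity (\int[lambda]_t (c%:E * (\1_(`[nrm y / 2, nrm y]%classic) t)%:E))%E.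
  apply: eq_integral => t _; rewrite -EFinM; congr (_%:E); rewrite /dilated_integrand.
  congr (_ * _); rewrite indicE; case: ifPn => h.
  - by rewrite mem_set//= in_itv.
  - by rewrite memNset//= in_itv/= (negbTE h).
have mE : measurable_fun setT (fun t : Rm => (\1_(`[nrm y / 2, nrm y]%classic) t : R)%:E).
  exact/measurable_EFinP/measurable_indic.
have i0 (t : R) : setT t -> (0 <= (\1_(`[nrm y / 2, nrm y]%classic) t : R)%:E)%E.
  by rewrite lee_fin.
rewrite ge0_integralZl// integral_indic//= setIT lebesgue_measure_itv/= lte_fin.
rewrite ifT; last by lra.
by rewrite -EFinD -EFinM /c; congr EFin; field; rewrite gt_eqF.
Qed.

Lemma cone_volume_polar r : dot q q < r ^+ 2 ->
  ((n%:R / 2)%:E * iter_int (fun y => (\1_(cone_ball r) y)%:E) =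
   iter_int (fun x => (\1_C x * shell_weight x * ray_length r x ^+ n)%:E))%E.
Proof.
move=> hr.
have mtt d (Z : measurableType d) : measurable_fun setT (fun _ : Z => tt) by exact: measurable_cst.
have mi := rv_measurable_EFin (cone_ball_measurable r).
rewrite -iter_intZ ?divr_ge0//.
transitivity (iter_int (fun y => \int[lambda]_t (dilated_integrand r t y)%:E)%E).
  (* At [y = 0] the two sides can differ, because [(nrm y)^-1] is 0 there by convention. *)
  apply: eq_iter_int_neq0.
  - move=> d Z y u my mu; apply: emeasurable_funM; first exact: measurable_cst.
    exact: (mi _ _ y).
  - by move=> v; rewrite mule_ge0// lee_fin// divr_ge0.
  - move=> d Z y u my mu.
    apply: (measurable_fun_fubini_tonelli_F (m2 := lambda)
      (fun p : (Z * Rm)%type => (dilated_integrand r p.2 (u p.1))%:E)).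
    + apply: (dilated_integrand_measurable r (y := fun p : (Z * Rm)%type => p.2)
        (u := fun p : (Z * Rm)%type => u p.1)); first exact: measurable_snd.
      by move=> i; exact: (measurableT_comp (mu i) measurable_fst).
    + by move=> p; rewrite lee_fin dilated_integrand_ge0.
  - by move=> v; apply: integral_ge0 => t _; rewrite lee_fin dilated_integrand_ge0.
  - by move=> v v0; rewrite integral_dilated_integrand// EFinM.
rewrite -(iter_int_swap (f := fun t y => (dilated_integrand r t y)%:E)); last 2 first.
- exact: dilated_integrand_measurable.
- by move=> t v; rewrite lee_fin dilated_integrand_ge0.
transitivity (\int[lambda]_t iter_int (fun x => (polar_integrand r t x)%:E))%E; last first.
  rewrite (iter_int_swap (f := fun t y => (polar_integrand r t y)%:E)); last 2 first.
  - exact: polar_integrand_measurable.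
  - by move=> t v; rewrite lee_fin polar_integrand_ge0.
  by apply: eq_iter_int => x; exact: integral_polar_integrand.
apply: eq_integral => t _.
(* For [t <= 0] both integrands vanish pointwise: [nrm v / 2 <= t] forces [v = 0], where
   [(nrm v)^-1 = 0]. *)
have [t0|t0] := ltP 0 t; last first.
  apply: eq_iter_int => v; congr (_%:E).
  rewrite /polar_integrand ltNge t0/= /dilated_integrand.
  have [->|v0] := eqVneq v 0; first by rewrite nrm0 invr0 !(mulr0, mul0r).
  have V0 := nrm_gt0 v0.
  by rewrite (_ : _ <= t = false) ?mulr0//; apply/negbTE; rewrite -ltNge; lra.
pose F v := ((t ^+ n)%:E * (dilated_integrand r t v)%:E)%E.
have mD : param_measurable (fun _ : unit => fun v => (dilated_integrand r t v)%:E).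
  move=> d Z y u my mu.
  by apply: (dilated_integrand_measurable r (y := fun _ : Z => t)) => //; exact: measurable_cst.
have D0 v : (0 <= (dilated_integrand r t v)%:E)%E by rewrite lee_fin dilated_integrand_ge0.
have tn0 : 0 <= t ^+ n by rewrite exprn_ge0// ltW.
transitivity (iter_int (fun v => F (t *: v + 0))); last first.
  by apply: eq_iter_int => v; rewrite /F addr0 polar_integrandE// EFinM.
rewrite iter_int_affine//; last 2 first.
- move=> d Z y u my mu; apply: emeasurable_funM; first exact: measurable_cst.
  exact: (mD _ _ y).
- by move=> v; rewrite mule_ge0.
rewrite /F iter_intZ// muleA -EFinM mulVf ?mul1e//.
by rewrite expf_neq0// gt_eqF.
Qed.

End ConeVolume.

Lemma signed_int_sum (R : realType) (k : nat) (b : R) (b0 : 0 <= b)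
    (N : nat) (c : nat -> R) (F : nat -> 'rV[R]_k -> R) :
  (forall j, rv_measurable (F j)) -> (forall j, exists M, box_bounded b M (F j)) ->
  [/\ rv_measurable (fun v => \sum_(j < N) c j * F j v),
      exists M', box_bounded b M' (fun v => \sum_(j < N) c j * F j v) &
      signed_int (fun v => \sum_(j < N) c j * F j v) =
        \sum_(j < N) c j * signed_int (F j)].
Proof.
move=> mF bF; elim: N => [|N [mN [M' bN] eN]].
  have e0 : (fun v : 'rV[R]_k => \sum_(j < 0) c j * F j v) = fun=> 0.
    by apply/funext => v; rewrite big_ord0.
  have bz : box_bounded b 0 (fun _ : 'rV[R]_k => 0).
    by move=> v; rewrite normr0 mul0r.
  rewrite e0 big_ord0; split; first exact: rv_measurable_cst.
  - by exists 0.
  - have := signed_int_le b0 (rv_measurable_cst 0) bz.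
    by rewrite mul0r normr_le0 => /eqP.
have eS : (fun v => \sum_(j < N.+1) c j * F j v) =
    fun v => \sum_(j < N) c j * F j v + c N * F N v.
  by apply/funext => v; rewrite big_ord_recr.
have [M bM] := bF N; rewrite eS big_ord_recr/= -eN; split.
- by apply: rv_measurableD => //; apply: rv_measurableM => //; exact: rv_measurable_cst.
- by exists (M' + `|c N| * M); apply: box_boundedD => //; exact: box_boundedZ.
- exact: (signed_int_lin b0 _ mN bN (mF N) bM).
Qed.

(** * Expansion of the cone volume in powers of the radius *)

Section ConeExpansion.
Context {R : realType} (m : nat).
Local Notation n := m.+1.
Local Notation Rm := (measurableTypeR R).
Variables (C : set 'rV[R]_n) (q : 'rV[R]_n).
Hypothesis mC : rv_measurable (\1_C).
Hypothesis coneC : forall (t : R) x, 0 < t -> C (t *: x) <-> C x.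

Implicit Types (x y : 'rV[R]_n) (r t : R).

(** The part independent of [r] in the binomial term of degree [j] of [ray_length ^+ n]; of the
    [n.+1] factors [1 / |x|], one comes from [shell_weight] and [n] from [ray_length]. *)
Definition ray_kernel (j : nat) x : R :=
  \1_C x * (\1_(@shell R m) x * (nrm x)^-1 ^+ n.+1) * ray_slope q x ^+ (n - j).

Definition ray_moment (j k : nat) : R :=
  signed_int (fun x => ray_kernel j x * ray_dist2 q x ^+ k).

Let Q := dot q q.
Let B := (1 + Q) ^+ n.

Lemma ray_slope_measurable : rv_measurable (ray_slope q).
Proof.
move=> d Z y u my mu; apply: measurable_funM; last exact: nrmV_measurable.
by apply: measurableT_comp => //; apply: dot_measurable => //; exact: coord_measurable_cst.
Qed.

Lemma ray_dist2_measurable : rv_measurable (ray_dist2 q).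
Proof.
apply: rv_measurableD; first exact: rv_measurable_cst.
apply: rv_measurableN => d Z y u my mu; apply: measurable_funX.
exact: (ray_slope_measurable my).
Qed.

Lemma rv_measurableX k (f : 'rV[R]_n -> R) :
  rv_measurable f -> rv_measurable (fun x => f x ^+ k).
Proof. by move=> mf d Z y u my mu; apply: measurable_funX; exact: (mf _ _ y). Qed.

Lemma ray_root_measurable r :
  rv_measurable (fun x => Num.sqrt (1 - ray_dist2 q x * (r * r)^-1)).
Proof.
move=> d Z y u my mu; apply: (measurableT_comp (f := @Num.sqrt R)).
  by apply: continuous_measurable_fun; exact: sqrt_continuous.
apply: measurable_funB; first exact: measurable_cst.
by apply: measurable_funM; [exact: (ray_dist2_measurable my)|exact: measurable_cst].
Qed.

Lemma ray_kernel_measurable j : rv_measurable (ray_kernel j).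
Proof.
apply: rv_measurableM; last exact/rv_measurableX/ray_slope_measurable.
apply: rv_measurableM => //; apply: rv_measurableM; first exact: shell_measurable.
by apply: rv_measurableX => d Z y u my mu; exact: nrmV_measurable.
Qed.

(** From [s^2 <= Q] follows [|s| <= 1 + Q]; a base at least 1 lets the exponent [n - j] be raised to
    [n], uniformly in [j]. On the shell [1 / |x| <= 1], and the shell lies in the box of half-width
    2. *)
Lemma ray_kernel_le j x : `|ray_kernel j x| <= B * \1_(@box R n 2) x.
Proof.
have Q0 : 0 <= Q by exact: dot_ge0.
have a1 : `|ray_slope q x| <= 1 + Q.
  have := sqr_ray_slope_le q x; rewrite -/Q -real_normK ?num_real//.
  by move: `|ray_slope q x| => a; nra.
have i1 (A : set 'rV[R]_n) : `|\1_A x| <= 1 :> R.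
  by rewrite indicE; case: (_ \in _); rewrite /= ?normr1 ?normr0.
have [xS|xS] := boolP (x \in @shell R m); last first.
  rewrite /ray_kernel; have -> : \1_(@shell R m) x = 0 :> R by rewrite indicE (negbTE xS).
  by rewrite mul0r mulr0 mul0r normr0 mulr_ge0// exprn_ge0// addr_ge0.
have /andP[x1 x2] : 1 <= nrm x <= 2 by move: xS; rewrite inE.
have -> : \1_(@box R n 2) x = 1 :> R.
  by rewrite indicE mem_set// => i; exact: le_trans (ler_coord_nrm _ _) x2.
have p1 : `|(nrm x)^-1 ^+ n.+1| <= 1.
  rewrite normrX exprn_ile1// ger0_norm ?invr_ge0 ?nrm_ge0//.
  by rewrite invf_le1// (lt_le_trans ltr01).
rewrite mulr1 /ray_kernel; move: p1; move: ((nrm x)^-1 ^+ n.+1) => p p1.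
rewrite !normrM -[leRHS]mul1r ler_pM//.
- have h (a b : R) : `|a| <= 1 -> `|b| <= 1 -> `|a| * `|b| <= 1.
    by move=> ha hb; rewrite mulr_ile1.
  rewrite -[X in _ * X]normrM; apply: (h _ _) => //; rewrite normrM; exact: h.
- rewrite normrX; apply: (@le_trans _ _ ((1 + Q) ^+ (n - j))).
    by rewrite lerXn2r// ?nnegrE ?addr_ge0.
  by rewrite ler_weXn2l ?leq_subr// lerDl.
Qed.

Lemma box_bounded_kernelM j (D : R) (h : 'rV[R]_n -> R) :
  (forall x, `|h x| <= D) -> box_bounded 2 (B * D) (fun x => ray_kernel j x * h x).
Proof.
move=> hD x; rewrite normrM mulrAC ler_pM//; exact: ray_kernel_le.
Qed.

Lemma ray_dist2X_le k x : `|ray_dist2 q x ^+ k| <= Q ^+ k.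
Proof.
rewrite normrX lerXn2r ?nnegrE ?dot_ge0// ger0_norm ?ray_dist2_ge0//.
exact: ray_dist2_le.
Qed.

Lemma ray_moment_le j k : `|ray_moment j k| <= B * Q ^+ k * 4 ^+ n.
Proof.
(* [4 ^+ n] is the volume of the box of half-width 2. *)
have -> : 4 = 2 * 2 :> R by ring.
apply: signed_int_le => //; last by apply: box_bounded_kernelM => x; exact: ray_dist2X_le.
apply: rv_measurableM; first exact: ray_kernel_measurable.
exact/rv_measurableX/ray_dist2_measurable.
Qed.

(** Termwise integration in finite form: linearity turns the polynomial in [ray_dist2] into moments,
    and the uniform error [del] is integrated over a bounded box. *)
Lemma ray_kernel_approx j (h : 'rV[R]_n -> R) (D del e : R) (N : nat) (a : nat -> R) :
  rv_measurable h -> (forall x, `|h x| <= D) ->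
  (forall x, `|h x - \sum_(k < N) a k * (ray_dist2 q x * e) ^+ k| <= del) ->
  `|signed_int (fun x => ray_kernel j x * h x) -
    \sum_(k < N) a k * ray_moment j k * e ^+ k| <= B * del * 4 ^+ n.
Proof.
move=> mh hD hdel.
pose F k x := ray_kernel j x * ray_dist2 q x ^+ k.
pose c k := a k * e ^+ k.
have mF k : rv_measurable (F k).
  exact: rv_measurableM (ray_kernel_measurable j) (rv_measurableX k ray_dist2_measurable).
have bF k : exists M, box_bounded 2 M (F k).
  by exists (B * Q ^+ k); apply: box_bounded_kernelM => x; exact: ray_dist2X_le.
have b0 : 0 <= 2 :> R by [].
have [mS [M' bS] eS] := signed_int_sum b0 N c mF bF.
have mkh := rv_measurableM (ray_kernel_measurable j) mh.
have bkh := box_bounded_kernelM j hD.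
have -> : \sum_(k < N) a k * ray_moment j k * e ^+ k = \sum_(k < N) c k * signed_int (F k).
  by apply: eq_bigr => k _; rewrite /c mulrAC.
rewrite -eS -[X in _ - X]mul1r -mulNr -(signed_int_lin b0 (-1) mkh bkh mS bS).
have -> : 4 = 2 * 2 :> R by ring.
have eE x : ray_kernel j x * h x + -1 * (\sum_(k < N) c k * F k x) =
    ray_kernel j x * (h x - \sum_(k < N) a k * (ray_dist2 q x * e) ^+ k).
  rewrite mulrBr mulN1r; congr (_ - _); rewrite mulr_sumr; apply: eq_bigr => k _.
  by rewrite /c /F exprMn; ring.
apply: signed_int_le => //.
- apply: rv_measurableD => //; apply: rv_measurableM => //; exact: rv_measurable_cst.
- by move=> x; rewrite eE; exact: (box_bounded_kernelM j hdel x).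
Qed.

Lemma cone_volume_expansion r : 0 < r -> Q < r ^+ 2 ->
  fine (iter_int (fun y => (\1_(cone_ball C q r) y)%:E)) =
  2 / n%:R * \sum_(j < n.+1) ('C(n, j)%:R * r ^+ j) *
    signed_int (fun x => ray_kernel j x * Num.sqrt (1 - ray_dist2 q x * (r * r)^-1) ^+ j).
Proof.
move=> r0 hr.
pose s x := Num.sqrt (1 - ray_dist2 q x * (r * r)^-1).
have rr0 : 0 < r * r by rewrite mulr_gt0.
have s0 x : 0 <= s x by exact: sqrtr_ge0.
have s1 x : s x <= 1.
  rewrite -sqrtr1 ler_wsqrtr// lerBlDr lerDl mulr_ge0 ?ray_dist2_ge0// invr_ge0 ltW//.
have ms : rv_measurable s by exact: ray_root_measurable.
pose F j x := ray_kernel j x * s x ^+ j.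
have mF j : rv_measurable (F j).
  by apply: rv_measurableM; [exact: ray_kernel_measurable|exact: rv_measurableX].
have bF j : exists M, box_bounded 2 M (F j).
  exists (B * 1); apply: box_bounded_kernelM => x; by rewrite normrX exprn_ile1// ger0_norm.
have b0 : 0 <= 2 :> R by [].
pose c j : R := 'C(n, j)%:R * r ^+ j.
have [mS [M bS] eS] := signed_int_sum b0 n.+1 c mF bF.
have eF x : \1_C x * shell_weight x * ray_length q r x ^+ n = \sum_(j < n.+1) c j * F j x.
  have es : Num.sqrt (r ^+ 2 - ray_dist2 q x) = r * s x.
    rewrite (_ : _ - _ = r ^+ 2 * (1 - ray_dist2 q x * (r * r)^-1)).
      by rewrite sqrtrM ?sqr_ge0// sqrtr_sqr gtr0_norm.
    by field; rewrite gt_eqF.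
  rewrite /ray_length es expr_div_n exprDn mulr_suml mulr_sumr.
  apply: eq_bigr => j _; rewrite /c /F /ray_kernel /shell_weight -mulr_natl.
  by rewrite [(r * s x) ^+ j]exprMn [(nrm x)^-1 ^+ n.+1]exprS exprVn; ring.
have F0 x : 0 <= \sum_(j < n.+1) c j * F j x.
  rewrite -eF; apply: mulr_ge0; first by rewrite mulr_ge0// shell_weight_ge0.
  have [->|x0] := eqVneq x 0.
    by rewrite /ray_length nrm0 invr0 mulr0 expr0n.
  by rewrite exprn_ge0// ltW// ray_length_gt0.
have := cone_volume_polar mC coneC hr.
under [in X in _ = X]eq_iter_int => x do rewrite eF.
move=> H.
have [fS _] := box_bounded_iter_int b0 mS bS F0.
rewrite -eS (signed_int_ge0 b0 mS bS F0) -H.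
set I := iter_int _ in H *.
have n0 : n%:R != 0 :> R by rewrite pnatr_eq0.
(* Finiteness of the volume is read off the polar formula, whose right side is the integral of a
   bounded function on a box. *)
have fI : I \is a fin_num.
  have -> : I = ((2 / n%:R)%:E * ((n%:R / 2)%:E * I))%E.
    by rewrite muleA -EFinM (_ : _ * _ = 1) ?mul1e//; field.
  by rewrite fin_numM// H.
by rewrite fineM//=; field.
Qed.

End ConeExpansion.

(** * Reduction of polyhedra to cones *)

Section HalfspaceReduction.
Context {R : realType} (m : nat).
Local Notation n := m.+1.
Local Notation Rm := (measurableTypeR R).
Local Notation hs := ('rV[R]_n * R)%type.
Variable p0 : 'rV[R]_n.
Implicit Types (x p : 'rV[R]_n) (h : hs) (Z N s : seq hs) (r : R).

Definition in_half h x := dot h.1 x <= h.2.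

Definition half_region Z N : set 'rV[R]_n :=
  [set x | all (in_half^~ x) Z && all (fun h => ~~ in_half h x) N].

Definition region_volume Z N r : R :=
  fine (iter_int (fun x => (\1_(half_region Z N `&`
    [set x | dot (x - p0) (x - p0) <= r ^+ 2]) x)%:E)).

Lemma region_ball_indicE Z N r x :
  \1_(half_region Z N `&` [set x | dot (x - p0) (x - p0) <= r ^+ 2]) x =
  (if all (in_half^~ x) Z && all (fun h => ~~ in_half h x) N &&
     (dot (x - p0) (x - p0) <= r ^+ 2) then 1 else 0) :> R.
Proof.
rewrite indicE; case: ifPn => h; first by rewrite mem_set//; case/andP: h.
by rewrite memNset// => -[h1 h2]; move: h; rewrite h1/= h2.
Qed.

(** The exclusive or treats membership ([b = false]) and non-membership ([b = true]) together. *)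
Lemma all_in_half_measurable (b : bool) s d (Z : measurableType d)
    (u : Z -> 'rV[R]_n) : coord_measurable u ->
  measurable_fun setT (fun z => all (fun h => b (+) in_half h (u z)) s).
Proof.
move=> mu; elim: s => [|h s IH] /=; first exact: measurable_cst.
apply: measurable_and => //.
have mh : measurable_fun setT (fun z => in_half h (u z)).
  apply: measurable_fun_ler; last exact: measurable_cst.
  by apply: dot_measurable => //; exact: coord_measurable_cst.
by move: mh; clear IH; case: b => //= mh; exact: measurable_neg.
Qed.

Lemma region_ball_measurable Z N r : rv_measurable
  (\1_(half_region Z N `&` [set x | dot (x - p0) (x - p0) <= r ^+ 2])).
Proof.
move=> d T y u my mu.
rewrite (_ : (fun z => _) = fun z =>
  (if all (in_half^~ (u z)) Z && all (fun h => ~~ in_half h (u z)) N &&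
     (dot (u z - p0) (u z - p0) <= r ^+ 2) then 1 else 0)); last first.
  by apply/funext => z; rewrite region_ball_indicE.
apply: ifb_measurable; last exact: measurable_cst.
apply: measurable_and; last first.
  apply: measurable_fun_ler; last exact: measurable_cst.
  by apply: dot_measurable; apply: coord_measurableD => //; exact: coord_measurable_cst.
apply: measurable_and.
- exact: (all_in_half_measurable false Z mu).
- exact: (all_in_half_measurable true N mu).
Qed.

Lemma region_ball_box Z N r : 0 <= r -> box_bounded (r + nrm p0) 1
  (\1_(half_region Z N `&` [set x | dot (x - p0) (x - p0) <= r ^+ 2])).
Proof.
move=> r0 x; rewrite region_ball_indicE mul1r; case: ifPn => [/andP[_ h]|_]; last first.
  by rewrite normr0.
rewrite normr1 indicE mem_set// => i.
rewrite -(subrK (p0 ord0 i) (x ord0 i)); apply: le_trans (ler_normD _ _) (lerD _ _).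
- have -> : x ord0 i - p0 ord0 i = (x - p0) ord0 i by rewrite !mxE.
  apply: le_trans (ler_coord_nrm _ _) _.
  by rewrite -[leRHS]ger0_norm// -sqrtr_sqr ler_wsqrtr.
- exact: ler_coord_nrm.
Qed.

(** Cutting along [h] expands the products of indicators and complementary indicators one factor at
    a time. *)
Lemma region_volume_split h Z N r : 0 <= r ->
  region_volume Z N r = region_volume (h :: Z) N r + region_volume Z (h :: N) r.
Proof.
move=> r0; have b0 : 0 <= r + nrm p0 by rewrite addr_ge0// nrm_ge0.
rewrite /region_volume -(fine_iter_intD b0 (region_ball_measurable _ _ _)
  (region_ball_box _ _ r0) _ (region_ball_measurable _ _ _) (region_ball_box _ _ r0))//.
congr fine; apply: eq_iter_int => x; congr EFin; rewrite !region_ball_indicE/=.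
by case: (in_half h x); case: (all _ Z); case: (all _ N); case: (_ <= _);
  rewrite /= ?addr0 ?add0r.
Qed.

Lemma eq_region_volume Z Z' N N' : Z =i Z' -> N =i N' ->
  region_volume Z N = region_volume Z' N'.
Proof.
move=> eZ eN; apply/funext => r; congr fine; apply: eq_iter_int => x.
by rewrite !region_ball_indicE (eq_all_r eZ) (eq_all_r eN).
Qed.

Lemma central_region_volume s p r : (forall h, h \in s -> dot h.1 p = h.2) ->
  region_volume s [::] r =
  fine (iter_int (fun y => (\1_(cone_ball
    [set x | all (fun h => dot h.1 x <= 0) s] (p - p0) r) y)%:E)).
Proof.
move=> hp; congr fine.
(* A factor 1 in the shape of the Jacobian for [t = 1], so that [iter_int_affine] acts as a
   translation by [p]. *)
rewrite -[LHS]mul1e -[1%E]/((1 : R)%:E) -[1 in X in (X%:E * _)%E]invr1 -(expr1n _ n).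
rewrite -(iter_int_affine p ltr01); last 2 first.
- exact/rv_measurable_EFin/region_ball_measurable.
- by move=> v; rewrite lee_fin.
apply: eq_iter_int => v; congr EFin.
rewrite region_ball_indicE cone_ball_indicE scale1r/= andbT.
have -> : v + p - p0 = v + (p - p0) by rewrite addrA.
have -> : all (in_half^~ (v + p)) s = all (fun h => dot h.1 v <= 0) s.
  apply: eq_in_all => h hs; rewrite /in_half dotDr hp//.
  by rewrite -lerBrDr subrr.
rewrite indicE; case: (boolP (all _ s)) => H.
- by rewrite mem_set// mul1r.
- by rewrite memNset ?mul0r//; exact/negP.
Qed.

(* [Z] and [N] collect the halfspaces by the sign of the coefficient in the
   dependency given by the Fredholm alternative. *)
Lemma noncentral_empty s :
  ~ (exists p, forall h, h \in s -> dot h.1 p = h.2) ->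
  exists Z N, [/\ (size Z + size N)%N = size s, s =i Z ++ N &
                  half_region Z N = set0].
Proof.
move=> hs.
pose k := size s; pose t := in_tuple s.
pose A : 'M[R]_(n, k) := \matrix_(i, j) (tnth t j).1 ord0 i.
pose b : 'rV[R]_k := \row_j (tnth t j).2.
have [c [cA cb]] : exists c : 'cV[R]_k, A *m c = 0 /\ (b *m c) ord0 ord0 < 0.
  (* The columns of [A] are the normals, so a common point [p] of the hyperplanes is a solution of
     [p A = b]. Otherwise some column of the cokernel pairs nontrivially with [b], and its sign can
     be chosen. *)
  have /negP : ~ (b <= A)%MS.
    move=> /submxP[p bp]; apply: hs; exists p => h /(tnthP t)[j ->].
    move: bp => /rowP/(_ j); rewrite !mxE => ->.
    by apply: eq_bigr => i _; rewrite mxE mulrC.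
  rewrite submxE => /matrix0Pn[i [j]]; rewrite ord1 => ij.
  pose c := col j (cokermx A).
  have cA : A *m c = 0 by rewrite /c colE mulmxA mulmx_coker mul0mx.
  have cb : (b *m c) ord0 ord0 != 0.
    by rewrite /c colE mulmxA -colE mxE.
  move: cb; rewrite neq_lt => /orP[cb|cb]; first by exists c.
  exists (- c); rewrite !mulmxN cA oppr0; split => //.
  by rewrite mxE oppr_lt0.
pose Zi := [seq i <- enum 'I_k | 0 <= c i ord0].
pose Ni := [seq i <- enum 'I_k | ~~ (0 <= c i ord0)].
exists (map (tnth t) Zi), (map (tnth t) Ni); split.
- by rewrite !size_map !size_filter count_predC size_enum_ord.
- move=> h; rewrite mem_cat; apply/idP/orP.
  + move=> /(tnthP t)[j ->].
    have [cj|cj] := boolP (0 <= c j ord0); [left|right];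
      by apply: map_f; rewrite mem_filter cj mem_enum.
  + by case=> /mapP[j _ ->]; exact: mem_tnth.
- rewrite -subset0 => x; rewrite /half_region/= => /andP[/allP hZ /allP hN]; exfalso.
  (* In the region every summand is nonpositive, yet [A c = 0] makes the sum equal to
     [- b c > 0]. *)
  have : \sum_j c j ord0 * (dot (tnth t j).1 x - (tnth t j).2) <= 0.
    apply: sumr_le0 => j _; have [cj|cj] := boolP (0 <= c j ord0).
    - apply: mulr_ge0_le0 => //; rewrite subr_le0.
      by apply: hZ; apply: map_f; rewrite mem_filter cj mem_enum.
    - apply: mulr_le0_ge0; first by apply: ltW; rewrite ltNge.
      rewrite subr_ge0 ltW// ltNge.
      by apply: hN; apply: map_f; rewrite mem_filter cj mem_enum.
  under eq_bigr do rewrite mulrBr.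
  rewrite sumrB.
  have -> : \sum_j c j ord0 * dot (tnth t j).1 x = 0.
    transitivity (\sum_i (A *m c) i ord0 * x ord0 i); last first.
      by rewrite cA big1// => i _; rewrite mxE mul0r.
    under [RHS]eq_bigr do rewrite mxE mulr_suml.
    rewrite exchange_big; apply: eq_bigr => j _; rewrite mulr_sumr.
    by apply: eq_bigr => i _; rewrite mxE; ring.
  have -> : \sum_j c j ord0 * (tnth t j).2 = (b *m c) ord0 ord0.
    by rewrite mxE; apply: eq_bigr => j _; rewrite mxE mulrC.
  by rewrite sub0r oppr_le0 leNgt cb.
Qed.

(** * Induction on the number of halfspaces, for any class of functions containing the cone
    volumes *)

Section Induction.
Variable Good : (R -> R) -> Prop.
Hypothesis Good_ext : forall V W, (forall r, 0 < r -> V r = W r) -> Good V -> Good W.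
Hypothesis Good_sub : forall V W, Good V -> Good W -> Good (fun r => V r - W r).
Hypothesis Good_zero : Good (fun=> 0).
Hypothesis Good_cone : forall (C : set 'rV[R]_n) q, rv_measurable (\1_C) ->
  (forall (t : R) x, 0 < t -> C (t *: x) <-> C x) ->
  Good (fun r => fine (iter_int (fun y => (\1_(cone_ball C q r) y)%:E))).

Lemma Good_central s : (exists p, forall h, h \in s -> dot h.1 p = h.2) ->
  Good (region_volume s [::]).
Proof.
move=> [p hp]; apply: Good_ext (Good_cone (C := [set x | all (fun h => dot h.1 x <= 0) s])
   (p - p0) _ _).
- by move=> r r0; rewrite (central_region_volume _ hp).
- move=> d Z y u my mu.
  (* Zero offsets present the cone itself as an intersection of halfspaces. *)
  pose s' : seq hs := [seq (h.1, 0) | h <- s].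
  rewrite (_ : (fun z => _) = fun z => if all (in_half^~ (u z)) s' then 1 else 0).
    apply: ifb_measurable; last exact: measurable_cst.
    exact: (all_in_half_measurable false s' mu).
  apply/funext => z; rewrite indicE /s' all_map; case: ifPn => h; first by rewrite mem_set.
  by rewrite memNset//; exact/negP.
- by move=> t x t0; rewrite /= (@eq_all _ _ (fun h => dot h.1 x <= 0))// => h;
    rewrite dotZr pmulr_rle0.
Qed.

Lemma Good_empty Z N : half_region Z N = set0 -> Good (region_volume Z N).
Proof.
move=> e; apply: Good_ext Good_zero => r r0; rewrite /region_volume e set0I.
have -> : (fun x => (\1_(@set0 'rV[R]_n) x)%:E) = fun x => ((0 : R)%:E * 0%:E : \bar R)%E.
  by apply/funext => x; rewrite indic0 mul0e.
by rewrite iter_intZ ?mul0e.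
Qed.

(** Solving [region_volume_split] for the region outside [h] removes one complement without raising
    the number of halfspaces. *)
Lemma Good_region_small k : (forall s, (size s <= k)%N -> Good (region_volume s [::])) ->
  forall N Z, (size Z + size N <= k)%N -> Good (region_volume Z N).
Proof.
move=> IH; elim=> [|h N IHN] Z /=; first by rewrite addn0; exact: IH.
rewrite addnS => hk.
apply: Good_ext (Good_sub (IHN Z (ltnW hk)) (IHN (h :: Z) hk)) => r r0.
by rewrite (region_volume_split h _ _ (ltW r0)) addrC addKr.
Qed.

(** The volumes of [(Z, h :: N)] and [(h :: Z, N)] add up to that of [(Z, N)], which has one
    halfspace fewer and is already good. Goodness thus passes from one to the other, and a single
    good region, such as an empty one, yields the polyhedron. *)
Lemma Good_region_swap k : (forall s, (size s <= k)%N -> Good (region_volume s [::])) ->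
  forall N Z, (size Z + size N <= k.+1)%N -> Good (region_volume Z N) ->
  Good (region_volume (Z ++ N) [::]).
Proof.
move=> IH; elim=> [|h N IHN] Z /=; first by rewrite cats0.
rewrite addnS ltnS => hk GZ.
have G1 := Good_region_small IH hk.
rewrite (@eq_region_volume (Z ++ h :: N) ((h :: Z) ++ N) [::] [::])//; last first.
  by move=> g; rewrite !(mem_cat, inE) orbCA orbA.
apply: IHN => //; apply: Good_ext (Good_sub G1 GZ) => r r0.
by rewrite (region_volume_split h _ _ (ltW r0)) addrK.
Qed.

Lemma Good_polyhedron s : Good (region_volume s [::]).
Proof.
suff H k : forall s, (size s <= k)%N -> Good (region_volume s [::]) by exact: (H (size s)).
elim: k => [|k IH] {}s hk.
  (* Without halfspaces the region is the whole space, a cone with apex anywhere. *)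
  by apply: Good_central; exists 0 => h; rewrite (size0nil (_ : size s = 0%N))//;
    apply/eqP; rewrite -leqn0.
have [hc|/noncentral_empty [Z [N [eS e0 e]]]] := pselect
  (exists p, forall h, h \in s -> dot h.1 p = h.2); first exact: Good_central.
rewrite (eq_region_volume e0 (N' := [::]))//.
apply: (Good_region_swap IH); first by rewrite eS.
exact: Good_empty.
Qed.

End Induction.
End HalfspaceReduction.

(** * Conclusion *)

Lemma sum_f_R0E (a : nat -> R) (N : nat) : sum_f_R0 a N = \sum_(k < N.+1) a k.
Proof.
elim: N => [|N IH] /=; first by rewrite big_ord_recr big_ord0/= add0r.
by rewrite IH [RHS]big_ord_recr.
Qed.

Lemma meromorphic_at_infinity_sum (n L : nat) (c : nat -> R) (U : nat -> R -> R) :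
  (forall j, (j < L)%N -> meromorphic_at_infinity n (U j)) ->
  meromorphic_at_infinity n (fun r => \sum_(j < L) c j * U j r).
Proof.
elim: L => [|L IH] hU.
  apply: (@meromorphic_at_infinity_ext n (fun=> 0) _ 0) => [r _|].
    by rewrite big_ord0.
  exact: meromorphic_at_infinity_const.
apply: (@meromorphic_at_infinity_ext n
  (fun r => \sum_(j < L) c j * U j r + c L * U L r) _ 0) => [r _|].
  by rewrite big_ord_recr.
apply: meromorphic_at_infinity_lin; last exact: hU.
by apply: IH => j jL; apply: hU; exact: ltnW.
Qed.

(** * Cone volumes are meromorphic at infinity *)

Section Cone.
Variables (m : nat) (C : set 'rV[R]_m.+1) (q : 'rV[R]_m.+1).
Local Notation n := m.+1.
Hypothesis mC : rv_measurable (\1_C : _ -> R).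
Hypothesis coneC : forall (t : R) (x : 'rV[R]_n), 0 < t -> C (t *: x) <-> C x.

Definition ray_term (j : nat) (r : R) : R :=
  signed_int (fun x => ray_kernel C q j x *
    Num.sqrt (1 - ray_dist2 q x * (r * r)^-1) ^+ j).

Lemma ray_term_meromorphic j : (j <= n)%N ->
  meromorphic_at_infinity n (fun r => r ^+ j * ray_term j r).
Proof.
move=> jn.
pose al : R := Rdiv (INR j) (IZR 2).
have al0 : 0 <= al.
  apply/RleP; apply: Rmult_le_pos; first exact: pos_INR.
  by apply: Rlt_le; apply: Rinv_0_lt_compat; exact: (IZR_lt 0 2).
pose Q := dot q q; have Q0 : 0 <= Q by exact: dot_ge0.
pose B := (1 + Q) ^+ n.
have B0 : 0 <= B by rewrite exprn_ge0// addr_ge0.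
(* The binomial coefficients contribute [1 + al] and the moments [Q]; passing to [1 + Q] keeps [K]
   positive when [Q = 0]. *)
pose K := (1 + al) * (1 + Q).
have K0 : 0 < K by rewrite mulr_gt0// ltr_wpDr.
pose A k := binomial_coef al k * ray_moment C q j k.
have bA k : `|binomial_coef al k| <= (1 + al) ^+ k.
  by rewrite -RabsE -RpowE; apply/RleP; apply: binomial_coef_bound; exact/RleP.
apply: (@meromorphic_at_infinity_ext n (fun r => pow r j * ray_term j r) _ 0) => [r _|].
  by rewrite RpowE.
(* Beyond this threshold [r > 1] and [r * r > r > 2 (1 + al) Q], so [ray_dist2 q x / r^2] stays
   within the range of [sqrt_pow_approx]. *)
apply: (@meromorphic_at_infinity_approx n j A (B * 4 ^+ n) K
  (1 + 2 * (1 + al) * Q) (B * 4 ^+ n)).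
- exact/ssrnat.leP.
- exact/RltP.
- move=> k; apply/RleP; rewrite RabsE RpowE RmultE /A normrM /K exprMn.
  rewrite [leRHS]mulrCA [B * _ * _]mulrAC.
  rewrite ler_pM//; apply: le_trans (ray_moment_le q mC j k) _.
  rewrite ler_wpM2r ?exprn_ge0// ler_wpM2l// lerXn2r ?nnegrE// ?addr_ge0//.
  by rewrite -/Q lerDr.
- move=> r N /RltP hr; apply/RleP; rewrite RabsE RpowE RmultE RminusE sum_f_R0E RdivE.
  have r1 : 1 < r by apply: le_lt_trans hr; rewrite lerDl !mulr_ge0// addr_ge0.
  have r0 : 0 < r by apply: lt_trans r1.
  have rr0 : 0 < r * r by rewrite mulr_gt0.
  have s0 (x : 'rV[R]_n) : 0 <= ray_dist2 q x * (r * r)^-1.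
    by rewrite mulr_ge0 ?ray_dist2_ge0// invr_ge0 ltW.
  have su (x : 'rV[R]_n) : ray_dist2 q x * (r * r)^-1 <= (2 * (1 + al))^-1.
    rewrite ler_pdivrMr// mulrC ler_pdivlMr; last by rewrite mulr_gt0// ltr_wpDr.
    apply: (@le_trans _ _ (Q * (2 * (1 + al)))).
      by rewrite ler_wpM2r ?ray_dist2_le// mulr_ge0// addr_ge0.
    apply: (@le_trans _ _ r); last by rewrite ler_peMl ?(ltW r0)// ltW.
    by apply: le_trans (ltW hr); rewrite mulrC lerDr.
  have e1 : \sum_(k < N.+1) Rmult (A k) (pow (Rinv (Rmult r r)) k) =
     \sum_(k < N.+1) binomial_coef al k * ray_moment C q j k * (r * r)^-1 ^+ k.
    by apply: eq_bigr => k _; rewrite RpowE.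
  rewrite [X in `|_ - X|]e1.
  rewrite [leRHS]RmultE [leRHS]mulrAC.
  apply: (@ray_kernel_approx R m C q mC j _ 1).
  + exact/rv_measurableX/ray_root_measurable.
  + move=> x; rewrite normrX exprn_ile1// ger0_norm ?sqrtr_ge0//.
    by rewrite -[leRHS]sqrtr1 ler_wsqrtr// lerBlDr lerDl.
  + move=> x.
    have := @sqrt_pow_approx j N (ray_dist2 q x * (r * r)^-1).
    rewrite !RabsE ger0_norm// -/al => /(_ (RleP (su x))) /RleP.
    rewrite sum_f_R0E !RpowE RsqrtE.
    by under eq_bigr do rewrite -RmultE RpowE.
Qed.

Lemma cone_meromorphic : meromorphic_at_infinity n
  (fun r => fine (iter_int (fun y => (\1_(cone_ball C q r) y)%:E))).
Proof.
pose W r := \sum_(j < n.+1) 'C(n, j)%:R * (r ^+ j * ray_term j r).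
(* This threshold gives both [r > 0] and [|q|^2 < r^2]. The summand 0 fits the shape of
   [meromorphic_at_infinity_lin]. *)
apply: (@meromorphic_at_infinity_ext n (fun r => 0 + 2 / n%:R * W r) _ (1 + dot q q)).
  move=> r /RltP hr; have Q0 : 0 <= dot q q by exact: dot_ge0.
  have hr' : 1 + dot q q < r := hr.
  rewrite (cone_volume_expansion mC coneC); last 2 first.
  - by lra.
  - by nra.
  by rewrite add0r; congr (_ * _); apply: eq_bigr => j _; rewrite mulrA.
apply: meromorphic_at_infinity_lin; first exact: meromorphic_at_infinity_const.
apply: (@meromorphic_at_infinity_sum n n.+1 (fun j => 'C(n, j)%:R)
  (fun j r => r ^+ j * ray_term j r)) => j jn.
exact: ray_term_meromorphic.
Qed.

End Cone.

Lemma iter_integralE (n : nat) (f : 'rV[R]_n -> \bar R) : iter_integral f = iter_int f.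
Proof. by elim: n f => [//|n IH] f /=; apply: eq_integral => x _; exact: IH. Qed.

Lemma polyhedral_meromorphic (n : nat) (P : set 'rV[R]_n) (p0 : 'rV[R]_n) :
  polyhedral_set P -> meromorphic_at_infinity n (Vfun P p0).
Proof.
case=> -[x0 Px0] [k [a [b [_ PE]]]].
case: n => [|m] in P p0 x0 Px0 a PE *.
  (* In dimension 0 the nonempty [P] is the single point, whose volume is 1 by the base case of the
     integral. *)
  apply: (@meromorphic_at_infinity_ext 0 (fun=> 1) _ 0) => [r /RltP r0|].
    rewrite /Vfun ltNge (ltW r0)/= indicE mem_set//; split.
      by rewrite (_ : 0 = x0)//; apply/rowP => -[].
    by rewrite /cball/= /eucl_norm big_ord0 sqrtr0 ltW.
  exact: meromorphic_at_infinity_const.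
pose s := [seq (a i, b i) | i <- enum 'I_k].
apply: (@meromorphic_at_infinity_ext m.+1 (region_volume p0 s [::]) _ 0).
  move=> r /RltP r0; rewrite /Vfun ltNge (ltW r0)/= /region_volume.
  congr fine; rewrite /vol iter_integralE; apply: eq_iter_int => x; congr (_%:E).
  rewrite region_ball_indicE/= andbT indicE.
  have -> : (x \in P `&` cball p0 r) = all ((@in_half R m)^~ x) s && (dot (x - p0) (x - p0) <= r ^+ 2).
    rewrite in_setI; congr (_ && _).
      apply/idP/allP => [|H].
        rewrite inE PE => H h /mapP[i _ ->]; exact: (H i).
      by rewrite inE PE => i _; apply: (H (a i, b i)); apply: map_f; rewrite mem_enum.
    have -> : dot (x - p0) (x - p0) = \sum_i (x - p0) ord0 i ^+ 2.
      by apply: eq_bigr => i _; rewrite expr2.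
    have e : (x \in cball p0 r) = (Num.sqrt (\sum_i (x - p0) ord0 i ^+ 2) <= r).
      by apply/idP/idP; rewrite inE.
    by rewrite e -[r in LHS](ger0_norm (ltW r0)) -sqrtr_sqr ler_sqrt// sqr_ge0.
  by case: ifP => _.
apply: Good_polyhedron.
- move=> V W VW; apply: (@meromorphic_at_infinity_ext _ _ _ 0) => r /RltP; exact: VW.
- move=> V W hV hW.
  apply: (@meromorphic_at_infinity_ext _ (fun r => V r + (-1) * W r) _ 0) => [r _|].
    by rewrite mulN1r.
  exact: meromorphic_at_infinity_lin.
- exact: meromorphic_at_infinity_const.
- by move=> C q mC coneC; exact: cone_meromorphic.
Qed.

From Coquelicot Require Import Coquelicot.
From mathcomp Require Import all_boot all_algebra classical_sets.
Unset Implicit Arguments.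
Local Open Scope R_scope.

Theorem mainTheorem7 (n : nat) (P : set 'rV[R]_n) (p0 : 'rV[R]_n) :
  polyhedral_set P ->
  exists (rad : R) (F : C -> C),
    0 < rad /\
    (forall z : C, rad < Cmod z -> @ex_derive C_AbsRing C_NormedModule F z) /\
    (exists M R1 : R, forall z : C, R1 < Cmod z ->
        Cmod (F z) <= M * Cmod z ^ n) /\
    (forall r : R, rad < r -> F (RtoC r) = RtoC (Vfun P p0 r)).
Proof. exact (polyhedral_meromorphic p0). Qed.
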